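(* There exists a compact almost Kähler manifold $(M,J,\omega)$ of real dimension $8$ such that \[ \mathcal{H}^{2,2}_{BC}\not\supseteq\mathcal{H}^{2,2}_{\partial},\qquad \mathcal{H}^{2,2}_{A}\not\supseteq\mathcal{H}^{2,2}_{\overline\partial} \] and, for every $D\in\{BC,A,\overline\partial,\partial\}$, \[ \mathcal{H}^{2,2}_{D}\not\subseteq \mathbb{C}\,\omega^2\oplus L\left(P^{1,1}\cap\mathcal{H}^{1,1}_{D}\right)\oplus \left(P^{2,2}\cap \mathcal{H}^{2,2}_{D}\right). \]
   Context: Manifolds are smooth, connected and without boundary. An almost Hermitian manifold $(M,J,\omega)$ of real dimension $2n$ is a $2n$-manifold with an almost complex structure $J\in\mathrm{End}(TM)$, $J^2=-\mathrm{id}$ (not necessarily integrable), and a Riemannian metric $g$ with $g(J\cdot,J\cdot)=g(\cdot,\cdot)$, where $\omega(u,v)=g(Ju,v)$ is the fundamental form. It is almost Kähler if $d\omega=0$. Here $n=4$. $A^{p,q}$ is the space of smooth complex-valued $(p,q)$-forms with respect to $J$. The exterior derivative splits as $d=\mu+\partial+\overline\partial+\overline\mu$ with $\mu:A^{p,q}\to A^{p+2,q-1}$, $\partial:A^{p,q}\to A^{p+1,q}$, $\overline\partial:A^{p,q}\to A^{p,q+1}$, $\overline\mu:A^{p,q}\to A^{p-1,q+2}$. The $\mathbb{C}$-linear Hodge operator $*:A^{p,q}\to A^{n-q,n-p}$ is defined by $\alpha\wedge *\overline\beta=\langle\alpha,\beta\rangle\,\omega^n/n!$, where $\langle\cdot,\cdot\rangle$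 is the Hermitian inner product on forms induced by $g$. Set $\partial^*=-*\overline\partial*$ and $\overline\partial^*=-*\partial*$ (the $L^2$ formal adjoints). The Laplacians are $\Delta_{\partial}=\partial\partial^*+\partial^*\partial$, $\Delta_{\overline\partial}=\overline\partial\,\overline\partial^*+\overline\partial^*\overline\partial$, \[ \Delta_{BC}=\partial\overline\partial\,\overline\partial^*\partial^*+\overline\partial^*\partial^*\partial\overline\partial+\partial^*\overline\partial\,\overline\partial^*\partial+\overline\partial^*\partial\partial^*\overline\partial+\partial^*\partial+\overline\partial^*\overline\partial, \] \[ \Delta_{A}=\partial\overline\partial\,\overline\partial^*\partial^*+\overline\partial^*\partial^*\partial\overline\partial+\partial\overline\partial^*\overline\partial\partial^*+\overline\partial\partial^*\partial\overline\partial^*+\partial\partial^*+\overline\partial\,\overline\partial^*, \] and $\mathcal{H}^{p,q}_{D}=\ker\Delta_{D}\cap A^{p,q}$ for $D\in\{\partial,\overline\partial,BC,A\}$. $L=\omega\wedge\cdot$ is the Lefschetz operator and $\Lambda=*^{-1}L*$ its adjoint. A $j$-form $\alpha$, $j\le n$, is primitive if $\Lambda\alpha=0$, equivalently $L^{n-j+1}\alpha=0$. $P^{p,q}$ denotes the space of primitive $(p,q)$-forms, $p+q\le n$. *)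

(* Defs.v *)
From HB Require Import structures.
From mathcomp Require Import all_boot all_order all_algebra.
From mathcomp Require Import complex.
From mathcomp Require Import all_classical all_reals all_analysis.
Set Implicit Arguments.
Unset Strict Implicit.
Unset Printing Implicit Defensive.
Import Order.TTheory GRing.Theory Num.Theory.
Import numFieldNormedType.Exports.
Local Open Scope complex_scope.
Local Open Scope ring_scope.

(* Tangent vectors at a point of a chart are row vectors; an endomorphism M
   acts by v |-> v *m M, which is also the convention of [jacobian]. *)

(* u : ext R m stands for \sum_A u A dx_A, with dx_A = dx_a1 /\ ... /\ dx_ak
   for A = {a1 < ... < ak}. *)
Notation ext R m := {ffun {set 'I_m} -> R[i]}.

Section ExteriorAlgebra.
Context {R : realType} {m : nat}.

Implicit Types (u v : ext R m) (A B S K : {set 'I_m}).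

Definition dx A : ext R m := [ffun B => (B == A)%:R].

(* dx_A /\ dx_B = shuffle_sign A B dx_(A u B) for disjoint A and B *)
Definition shuffle_sign A B : R[i] :=
  (-1) ^+ #|[pred ab : 'I_m * 'I_m |
             [&& ab.1 \in A, ab.2 \in B & (ab.2 < ab.1)%N]]|.

Definition wedge u v : ext R m :=
  [ffun K : {set 'I_m} => \sum_(A : {set 'I_m} | A \subset K)
               shuffle_sign A (K :\: A) * u A * v (K :\: A)].

Definition covector (w : 'I_m -> R[i]) : ext R m := \sum_a w a *: dx [set a].

(* The index a runs through A in increasing order. *)
Definition wedge_family A (w : 'I_m -> ext R m) : ext R m :=
  \big[wedge/dx finset.set0]_(a in A) w a.

Definition conj_ext u : ext R m := [ffun A => (u A)^*].

(* The pullback of u under the linear map v |-> v *m T *)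
Definition pullback (T : 'M[R]_m) u : ext R m :=
  \sum_A u A *: wedge_family A (fun b => covector (fun a => (T a b)%:C)).

(* The parts (dx_a -+ 'i dx_a \o J) / 2 of dx_a of type (1,0) and (0,1) *)
Definition dx10 (J : 'M[R]_m) (a : 'I_m) : ext R m :=
  2^-1 *: (dx [set a] - 'i *: covector (fun b => (J b a)%:C)).
Definition dx01 (J : 'M[R]_m) (a : 'I_m) : ext R m :=
  2^-1 *: (dx [set a] + 'i *: covector (fun b => (J b a)%:C)).

(* The projection onto Lambda^{p,q}: expand each
   dx_A = /\_(a in A) (dx10 J a + dx01 J a) and keep the terms with p factors
   of type (1,0) and q factors of type (0,1). *)
Definition ext_bidegree (J : 'M[R]_m) (p q : nat) u : ext R m :=
  \sum_A u A *: \sum_(S : {set 'I_m} |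
                      [&& S \subset A, #|S| == p & #|A :\: S| == q])
    wedge_family A (fun a => if a \in S then dx10 J a else dx01 J a).

(* det (<dx_a, dx_b>), a in A, b in B, when #|A| = #|B|; the metric induced by
   g on covectors has matrix invmx g. *)
Definition gram (g : 'M[R]_m) A B : R :=
  if #|A| == #|B| then
    \det (\matrix_(i < #|A|, j < #|A|)
            invmx g (enum_val i) (nth (enum_val i) (enum B) j))
  else 0.

Definition ext_inner (g : 'M[R]_m) u v : R[i] :=
  \sum_A \sum_B u A * (v B)^* * (gram g A B)%:C.

(* omega = \sum_(a < b) omega_ab dx_a /\ dx_b, omega_ab = g (J e_a, e_b) *)
Definition ext_omega (J g : 'M[R]_m) : ext R m :=
  2^-1 *: \sum_a \sum_b ((J *m g) a b)%:C *: wedge (dx [set a]) (dx [set b]).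

Definition ext_vol (n : nat) (J g : 'M[R]_m) : ext R m :=
  (n`!%:R)^-1 *: iter n (wedge (ext_omega J g)) (dx finset.set0).

(* The coefficient at K is read off from
   dx_(~: K) /\ * u = <dx_(~: K), conj u> vol; see [ext_starP]. *)
Definition ext_star (n : nat) (J g : 'M[R]_m) u : ext R m :=
  [ffun K : {set 'I_m} => shuffle_sign (~: K) K *
     ext_inner g (dx (~: K)) (conj_ext u) * ext_vol n J g [set: 'I_m]].

(* [ext_star] is bijective when J and g are compatible; 0 is a dummy value. *)
Definition ext_starinv (n : nat) (J g : 'M[R]_m) u : ext R m :=
  xget 0 [set v | ext_star n J g v = u]%classic.

Lemma ext_innerE g u v :
  ext_inner g u v = \sum_A u A * ext_inner g (dx A) v.
Proof.
rewrite /ext_inner; apply: eq_bigr => A _.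
rewrite [in RHS](bigD1 A) //= [X in _ + X]big1 ?addr0 => [|B BA]; last first.
  by apply: big1 => C _; rewrite ffunE (negbTE BA) !mul0r.
rewrite mulr_sumr; apply: eq_bigr => B _.
by rewrite ffunE eqxx mul1r mulrA.
Qed.

Lemma ext_starP n J g u v :
  wedge u (ext_star n J g (conj_ext v)) [set: 'I_m] =
  ext_inner g u v * ext_vol n J g [set: 'I_m].
Proof.
rewrite ffunE ext_innerE mulr_suml; apply: eq_big => [A|A _].
  exact: finset.subsetT.
have -> : conj_ext v = [ffun A => (v A)^*] by [].
rewrite ffunE finset.setTD finset.setCK.
have -> : conj_ext [ffun A => (v A)^*] = v.
  by apply/ffunP => B; rewrite !ffunE conjCK.
rewrite -!mulrA mulrCA; congr (_ * _); rewrite !mulrA -expr2 sqrr_sign.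
by rewrite mul1r.
Qed.

End ExteriorAlgebra.

Local Open Scope classical_set_scope.

Section Smooth.
Context {R : realType} {m : nat}.

Definition partial (a : 'I_m) (f : 'rV[R]_m -> R) : 'rV[R]_m -> R :=
  fun x => 'D_(delta_mx 0 a) f x.

(* U is meant to be open. *)
Definition smooth_on (U : set 'rV[R]_m) (f : 'rV[R]_m -> R) : Prop :=
  forall (s : seq 'I_m) (x : 'rV[R]_m), U x ->
    {for x, continuous (foldr partial f s)} /\
    forall a : 'I_m, derivable (foldr partial f s) x (delta_mx 0 a).

End Smooth.

Record manifold (R : realType) (m : nat) := Manifold {
  carrier :> topologicalType;
  chart : Type;
  chart_dom : chart -> set carrier;
  chart_im : chart -> set 'rV[R]_m;
  chart_map : chart -> carrier -> 'rV[R]_m;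
  chart_inv : chart -> 'rV[R]_m -> carrier;
  open_chart_dom : forall c, open (chart_dom c);
  open_chart_im : forall c, open (chart_im c);
  chart_map_im : forall c x, chart_dom c x -> chart_im c (chart_map c x);
  chart_inv_dom : forall c y, chart_im c y -> chart_dom c (chart_inv c y);
  chart_mapK : forall c x, chart_dom c x -> chart_inv c (chart_map c x) = x;
  chart_invK : forall c y, chart_im c y -> chart_map c (chart_inv c y) = y;
  chart_map_continuous : forall c x, chart_dom c x ->
    {for x, continuous (chart_map c)};
  chart_inv_continuous : forall c y, chart_im c y ->
    {for y, continuous (chart_inv c)};
  chart_cover : forall x, exists c, chart_dom c x;
  chart_smooth : forall c c' a,
    smooth_on [set y | chart_im c y /\ chart_dom c' (chart_inv c y)]
              (fun y => chart_map c' (chart_inv c y) 0 a);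
  manifold_hausdorff : hausdorff_space carrier;
  manifold_second_countable : @second_countable carrier;
  manifold_connected : connected [set: carrier]
}.

Section Transition.
Context {R : realType} {m : nat} {X : manifold R m}.
Implicit Types c : chart X.

Definition transition c c' (y : 'rV[R]_m) : 'rV[R]_m :=
  chart_map c' (chart_inv c y).

Definition overlap c c' : set 'rV[R]_m :=
  [set y | chart_im c y /\ chart_dom c' (chart_inv c y)].

End Transition.

(* J and g are given by their matrices in each chart (only the values on
   [chart_im c] matter), related by the tensor transformation laws. *)
Record almost_Hermitian (R : realType) (n : nat) := AlmostHermitian {
  ah_manifold :> manifold R n.*2;
  ah_J : chart ah_manifold -> 'rV[R]_(n.*2) -> 'M[R]_(n.*2);
  ah_g : chart ah_manifold -> 'rV[R]_(n.*2) -> 'M[R]_(n.*2);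
  ah_J_smooth : forall c a b, smooth_on (chart_im c) (fun y => ah_J c y a b);
  ah_g_smooth : forall c a b, smooth_on (chart_im c) (fun y => ah_g c y a b);
  ah_J_tensor : forall c c' y, overlap c c' y ->
    let T := jacobian (transition c c') y in
    ah_J c y *m T = T *m ah_J c' (transition c c' y);
  ah_g_tensor : forall c c' y, overlap c c' y ->
    let T := jacobian (transition c c') y in
    ah_g c y = T *m ah_g c' (transition c c' y) *m T^T;
  ah_J_sqr : forall c y, chart_im c y -> ah_J c y *m ah_J c y = - 1%:M;
  ah_g_sym : forall c y, chart_im c y -> (ah_g c y)^T = ah_g c y;
  ah_g_pos : forall c y, chart_im c y ->
    forall v : 'rV[R]_(n.*2), v != 0 -> 0 < (v *m ah_g c y *m v^T) 0 0;
  ah_g_J : forall c y, chart_im c y ->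
    ah_J c y *m ah_g c y *m (ah_J c y)^T = ah_g c y
}.

Section Forms.
Context {R : realType} {n : nat} (X : almost_Hermitian R n).
Local Notation V := 'rV[R]_(n.*2).

(* A family of local expressions, one for each chart c, with no condition: the
   operators below act chart by chart.  Global smooth forms are singled out by
   [is_form], and equality of forms is [eq_form]. *)
Local Notation dform := (chart X -> V -> ext R n.*2).

Implicit Types alpha beta : dform.

Definition eq_form alpha beta : Prop :=
  forall c y, chart_im c y -> alpha c y = beta c y.

Definition is_form alpha : Prop :=
  (forall c A,
     smooth_on (chart_im c) (fun y => complex.Re (alpha c y A)) /\
     smooth_on (chart_im c) (fun y => complex.Im (alpha c y A))) /\
  (forall c c' y, overlap c c' y ->
     alpha c y =
     pullback (jacobian (transition c c') y) (alpha c' (transition c c' y))).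

Definition cpartial (a : 'I_(n.*2)) (f : V -> R[i]) (y : V) : R[i] :=
  partial a (fun z => complex.Re (f z)) y +i*
  partial a (fun z => complex.Im (f z)) y.

Definition exterior_d alpha : dform := fun c y =>
  [ffun K : {set 'I_(n.*2)} => \sum_(a in K)
     (-1) ^+ #|[pred b in K | (b < a)%N]| *
     cpartial a (fun z => alpha c z (K :\ a)) y].

Definition bidegree (p q : nat) alpha : dform := fun c y =>
  ext_bidegree (ah_J c y) p q (alpha c y).

Definition is_pq_form (p q : nat) : set dform :=
  [set alpha | is_form alpha /\ eq_form (bidegree p q alpha) alpha].

Definition del alpha : dform :=
  \sum_(p < n.+1) \sum_(q < n.+1)
    bidegree p.+1 q (exterior_d (bidegree p q alpha)).

Definition delbar alpha : dform :=
  \sum_(p < n.+1) \sum_(q < n.+1)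
    bidegree p q.+1 (exterior_d (bidegree p q alpha)).

Definition omega : dform := fun c y => ext_omega (ah_J c y) (ah_g c y).

Definition almost_Kahler : Prop := eq_form (exterior_d omega) 0.

Definition star alpha : dform := fun c y =>
  ext_star n (ah_J c y) (ah_g c y) (alpha c y).

Definition starinv alpha : dform := fun c y =>
  ext_starinv n (ah_J c y) (ah_g c y) (alpha c y).

Definition del_adj alpha : dform := - star (delbar (star alpha)).
Definition delbar_adj alpha : dform := - star (del (star alpha)).

Variant laplacian_kind := Lap_del | Lap_delbar | Lap_BC | Lap_A.

Definition laplacian (D : laplacian_kind) alpha : dform :=
  match D with
  | Lap_del => del (del_adj alpha) + del_adj (del alpha)
  | Lap_delbar => delbar (delbar_adj alpha) + delbar_adj (delbar alpha)
  | Lap_BC =>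
      del (delbar (delbar_adj (del_adj alpha)))
      + delbar_adj (del_adj (del (delbar alpha)))
      + del_adj (delbar (delbar_adj (del alpha)))
      + delbar_adj (del (del_adj (delbar alpha)))
      + del_adj (del alpha) + delbar_adj (delbar alpha)
  | Lap_A =>
      del (delbar (delbar_adj (del_adj alpha)))
      + delbar_adj (del_adj (del (delbar alpha)))
      + del (delbar_adj (delbar (del_adj alpha)))
      + delbar (del_adj (del (delbar_adj alpha)))
      + del (del_adj alpha) + delbar (delbar_adj alpha)
  end.

Definition harmonic_forms (D : laplacian_kind) (p q : nat) : set dform :=
  [set alpha | is_pq_form p q alpha /\ eq_form (laplacian D alpha) 0].

Definition wedge_form alpha beta : dform := fun c y =>
  wedge (alpha c y) (beta c y).

Definition lefschetz alpha : dform := wedge_form omega alpha.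
Definition lefschetz_adj alpha : dform := starinv (lefschetz (star alpha)).

Definition primitive (p q : nat) : set dform :=
  [set alpha | is_pq_form p q alpha /\ eq_form (lefschetz_adj alpha) 0].

Definition scale_form (z : R[i]) alpha : dform := fun c y => z *: alpha c y.

Definition lefschetz_sum22 (D : laplacian_kind) : set dform :=
  [set alpha | exists z beta gamma,
     [/\ (primitive 1 1 `&` harmonic_forms D 1 1) beta,
         (primitive 2 2 `&` harmonic_forms D 2 2) gamma &
         eq_form alpha
           (scale_form z (wedge_form omega omega) + lefschetz beta + gamma)]].

End Forms.

Arguments harmonic_forms {R n} X D p q.
Arguments lefschetz_sum22 {R n} X D.

(* Main.v *)
Require Import Defs.
From HB Require Import structures.
From mathcomp Require Import all_boot all_order all_algebra.
From mathcomp Require Import complex.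
From mathcomp Require Import all_classical all_reals all_analysis.
From mathcomp Require Import ring lra zify.
Set Implicit Arguments.
Unset Strict Implicit.
Unset Printing Implicit Defensive.
Import Order.TTheory GRing.Theory Num.Theory.
Import numFieldNormedType.Exports.
Local Open Scope complex_scope.
Local Open Scope ring_scope.

(* Proof idea.  On the torus R^8 / (pi Z)^8 with coordinates x1, y1, ..., x4, y4,
   keep the constant symplectic form omega = dx1 dy1 + ... + dx4 dy4 and take the
   compatible almost complex structure whose unitary (1,0)-coframe is
   phi_j = dx_j + i dy_j for j <> 2 and phi_2 = e^u dx2 + i e^-u dy2, where
   u = sin (2 x1).  The only nonzero differential is d phi_2 = du /\ conj phi_2,
   and du = cos (2 x1) (phi_1 + conj phi_1), so that
     del phi_2 = 0,  delbar phi_2 = cos (2 x1) phi_1 /\ conj phi_2.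
   Write omega_j = dx_j dy_j, a = phi_2 /\ conj phi_3 and b = conj phi_2 /\ phi_3.
   - omega_4 /\ a is del-harmonic but not delbar-closed, hence not BC-harmonic;
     omega_1 /\ a is delbar-harmonic but not A-harmonic.
   - 2 omega_1 /\ b = L b + (omega_1 - omega_4) /\ b is harmonic for del and BC,
     while its primitive part b is not.
   - 2 omega_4 /\ b = L b + (omega_4 - omega_1) /\ b is harmonic for delbar and A,
     while its primitive (2,2)-part (omega_4 - omega_1) /\ b is not.
   The pointwise Lefschetz decomposition is unique, so these forms lie outside
   the sums.  All forms involved are combinations of wedge products of phi_j,
   conj phi_j and omega_j with coefficients polynomial in cos (2 x1) and
   sin (2 x1); on these the operators act by explicit symbolic rules, which lets
   the Laplacians be evaluated by computation. *)

(** * Exterior algebra *)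

(** The weights e^u and e^-u of phi_2 have opposite logarithmic derivatives, which is why
    differentiation turns phi_2 into its conjugate; their product is 1, which keeps omega constant.
    Two facts select the witnesses: omega_1 is killed by du, so omega_1 /\ a and omega_1 /\ b are
    closed; and the Hodge star exchanges omega_1 and omega_4 in these products up to a constant, so
    those with omega_4 are coclosed. On the remaining side the bidegree decides which of del and
    delbar survives. The factor phi_3 or its conjugate completes the bidegree (1,1). For the
    harmonic witnesses the rightmost operator in every term of the Laplacian already vanishes. For
    the other forms the Laplacian itself is shown to be nonzero at the origin, where the coframe is
    dx_j + i dy_j. The obstacle is that bidegree, star and Lambda are defined through index sets,
    shuffle signs and Gram determinants. Grouping the coordinates into consecutive pairs x_j, y_j
    makes them act pair by pair on monomials, with one global sign for the star. *)

Section LeftMultiplication.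
Context {R : realType} {m : nat}.
Implicit Types (u : ext R m) (A K : {set 'I_m}) (v w : 'I_m -> R[i]) (c : R[i]) (a b : 'I_m).

Lemma extZE c u A : (c *: u) A = c * u A. Proof. by rewrite ffunE. Qed.

Lemma ext0E A : (0 : ext R m) A = 0. Proof. by rewrite ffunE. Qed.

Lemma extDE u1 u2 A : (u1 + u2) A = u1 A + u2 A. Proof. by rewrite ffunE. Qed.

Lemma extNE u A : (- u) A = - u A. Proof. by rewrite ffunE. Qed.

Lemma dxE A B : dx A B = (B == A)%:R :> R[i]. Proof. by rewrite ffunE. Qed.

(** The sign exponent common to multiplication by dx_a and to [exterior_d]; this is what later turns
    d into a left multiplication by dx1. *)
Definition below (a : 'I_m) K : nat := #|[pred b in K | (b < a)%N]|.

Lemma below_setD1 a b K : a \in K ->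
  below b K = ((a < b) + below b (K :\ a))%N.
Proof.
move=> aK; rewrite /below (cardD1 a) !inE aK /=; congr (_ + _)%N.
by apply: fintype.eq_card => c; rewrite !inE andbA.
Qed.

Lemma covectorE v A : covector v A = \sum_a v a * (A == [set a])%:R.
Proof.
rewrite /covector sum_ffunE; apply: eq_bigr => a _.
by rewrite ffunE /dx ffunE.
Qed.

Lemma shuffle_sign1 a K :
  shuffle_sign [set a] (K :\ a) = (-1) ^+ below a K :> R[i].
Proof.
rewrite /shuffle_sign /below; congr (_ ^+ _).
rewrite -[RHS](@fintype.card_image _ _ (fun b => (a, b))); last by move=> b c [].
apply: fintype.eq_card => -[c b]; rewrite !inE /=; apply/idP/fintype.imageP.
  move=> /and3P[/eqP-> /andP[ba bK] lt_ba]; exists b => //.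
  by rewrite inE bK.
by move=> [d]; rewrite inE => /andP[dK da] [-> ->]; rewrite eqxx neq_ltn da dK.
Qed.

Lemma wedge_covectorE v u K :
  wedge (covector v) u K = \sum_(a in K) (-1) ^+ below a K * v a * u (K :\ a).
Proof.
rewrite ffunE.
under eq_bigr => A _ do rewrite covectorE mulr_sumr mulr_suml.
rewrite exchange_big [RHS]big_mkcond; apply: eq_bigr => a _ /=.
case: ifPn => aK; last first.
  apply: big1 => A AK; case: eqP => [Aa|_]; last by rewrite !(mulr0, mul0r).
  by move: AK; rewrite Aa finset.sub1set (negbTE aK).
rewrite (bigD1 [set a]) ?finset.sub1set //= big1 ?addr0 => [|A /andP[_ /negbTE->]].
  by rewrite eqxx mulr1 shuffle_sign1.
by rewrite !(mulr0, mul0r).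
Qed.

(** Products of 1-forms are built by iterated left multiplication, for which [lmulC] plays the part
    of associativity and graded commutativity. *)
Definition lmul v u : ext R m := wedge (covector v) u.

Lemma lmulE v u K :
  lmul v u K = \sum_(a in K) (-1) ^+ below a K * v a * u (K :\ a).
Proof. exact: wedge_covectorE. Qed.

Lemma lmul_sumr v (I : Type) (r : seq I) (P : pred I) (F : I -> ext R m) :
  lmul v (\sum_(i <- r | P i) F i) = \sum_(i <- r | P i) lmul v (F i).
Proof.
apply/ffunP => K; rewrite sum_ffunE lmulE.
under [RHS]eq_bigr => i _ do rewrite lmulE.
rewrite exchange_big; apply: eq_bigr => a _ /=.
by rewrite sum_ffunE mulr_sumr.
Qed.

Lemma lmulZr v c u : lmul v (c *: u) = c *: lmul v u.
Proof.
apply/ffunP => K; rewrite extZE !lmulE mulr_sumr.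
by apply: eq_bigr => a _; rewrite extZE mulrCA.
Qed.

Lemma lmulDr v u1 u2 : lmul v (u1 + u2) = lmul v u1 + lmul v u2.
Proof.
apply/ffunP => K; rewrite extDE !lmulE -big_split.
by apply: eq_bigr => a _; rewrite extDE /= mulrDr.
Qed.

Lemma lmul0r v : lmul v 0 = 0.
Proof. by have := lmulZr v 0 0; rewrite !scale0r. Qed.

Lemma lmul_suml (I : Type) (r : seq I) (c : I -> R[i]) (V : I -> 'I_m -> R[i]) u :
  lmul (fun a => \sum_(i <- r) c i * V i a) u =
  \sum_(i <- r) c i *: lmul (V i) u.
Proof.
apply/ffunP => K; rewrite sum_ffunE lmulE.
under [RHS]eq_bigr => i _ do rewrite extZE lmulE mulr_sumr.
rewrite exchange_big; apply: eq_bigr => a _ /=.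
rewrite mulr_sumr mulr_suml; apply: eq_bigr => i _.
by rewrite mulrCA !mulrA.
Qed.

(** The coefficient at K is a sum over ordered pairs of distinct elements a, b of K. Deleting them
    in either order leaves the same set, and the signs are opposite because exactly one of a < b and
    b < a holds. *)
Lemma lmulC v w u : lmul v (lmul w u) = - lmul w (lmul v u).
Proof.
apply/ffunP => K; rewrite extNE !lmulE.
under eq_bigr => a _ do rewrite lmulE mulr_sumr.
under [in RHS]eq_bigr => a _ do rewrite lmulE mulr_sumr.
rewrite (exchange_big_dep (mem K)) /= => [|a b aK]; last first.
  by rewrite !inE => /andP[].
rewrite -sumrN; apply: eq_bigr => b bK; rewrite -sumrN.
apply: eq_big => [a|a /andP[aK]]; first by rewrite !inE bK andbT eq_sym andbC.
rewrite !inE => /andP[ba _].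
have -> : K :\ a :\ b = K :\ b :\ a.
  by apply/setP => c; rewrite !inE andbCA.
rewrite (below_setD1 a bK) (below_setD1 b aK) !exprD.
have : (-1) ^+ (b < a)%N = - (-1) ^+ (a < b)%N :> R[i].
  by case: ltngtP ba => [|//|/val_inj->]; rewrite ?expr0 ?expr1 ?opprK ?eqxx.
by move=> ->; ring.
Qed.

Lemma lmul_sqr v u : lmul v (lmul v u) = 0.
Proof.
have := lmulC v v u => /eqP; rewrite -subr_eq0 opprK -mulr2n -scaler_nat.
by rewrite scaler_eq0 pnatr_eq0 => /eqP.
Qed.

Definition delta (a : 'I_m) : 'I_m -> R[i] := fun b => (b == a)%:R.

Lemma ext_sum u : u = \sum_A u A *: dx A.
Proof.
apply/ffunP => K; rewrite sum_ffunE (bigD1 K) //= big1 => [|A AK].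
  by rewrite addr0 extZE dxE eqxx mulr1.
by rewrite extZE dxE eq_sym (negbTE AK) mulr0.
Qed.

Lemma lmul_delta_dx a A :
  lmul (delta a) (dx A) =
  if a \in A then 0 else (-1) ^+ below a A *: dx (a |: A).
Proof.
apply/ffunP => K; rewrite lmulE.
have -> : \sum_(b in K) (-1) ^+ below b K * delta a b * dx A (K :\ b) =
  if a \in K then (-1) ^+ below a K * (K :\ a == A)%:R else 0 :> R[i].
  rewrite big_mkcond (bigD1 a) //= big1 => [|b /negbTE ba]; last first.
    by rewrite /delta ba mulr0 mul0r if_same.
  by rewrite /delta eqxx addr0 mulr1 dxE.
case: ifPn => aK; case: ifPn => aA; rewrite ?extZE ?dxE ?ffunE //=.
- case: eqP => [KA|]; last by rewrite mulr0.
  by move: aA; rewrite -KA !inE eqxx.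
- have -> : (K :\ a == A) = (K == a |: A).
    apply/eqP/eqP => [<-|->]; first by rewrite finset.setD1K.
    by rewrite finset.setU1K.
  case: eqP => [->|_]; rewrite ?mulr0 ?mulr1 //.
  rewrite (below_setD1 a (a := a)) ?finset.setU11 // ltnn add0n.
  by rewrite finset.setU1K.
- case: eqP => [Ka|_]; last by rewrite mulr0.
  by move: aK; rewrite Ka !inE eqxx.
Qed.

Lemma below_min a A : (forall b, b \in A -> (a < b)%N) -> below a A = 0%N.
Proof.
move=> aA; apply: fintype.eq_card0 => b; rewrite !inE.
by apply/negP => /andP[/aA]; lia.
Qed.

Lemma notin_min a A : (forall b, b \in A -> (a < b)%N) -> a \notin A.
Proof. by move=> aA; apply/negP => /aA; rewrite ltnn. Qed.

Lemma lmul_delta_min a A : (forall b, b \in A -> (a < b)%N) ->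
  lmul (delta a) (dx A) = dx (a |: A).
Proof.
move=> aA; rewrite lmul_delta_dx (negbTE (notin_min aA)) (below_min aA).
by rewrite scale1r.
Qed.

(** Adjoining an element below all others creates no sign in [lmul_delta_dx] and prepends to the
    increasing enumeration behind [wedge_family], so this induction fits both. *)
Lemma set_min_ind (P : {set 'I_m} -> Prop) :
  P finset.set0 ->
  (forall a A, (forall b, b \in A -> (a < b)%N) -> P A -> P (a |: A)) ->
  forall A, P A.
Proof.
move=> P0 Pmin A; move: {2}#|A| (erefl #|A|) => n.
elim: n A => [A /eqP|n IHn A cA]; first by rewrite cards_eq0 => /eqP->.
have /card_gt0P[a0 a0A] : (0 < #|A|)%N by rewrite cA.
case: (arg_minnP val a0A) => a aA amin.
rewrite -(finset.setD1K aA); apply: Pmin => [b|].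
  rewrite !inE => /andP[ba /amin]; rewrite leq_eqVlt => /orP[/eqP/val_inj ab|//].
  by rewrite ab eqxx in ba.
by apply: IHn; move: cA; rewrite (cardsD1 a) (aA : a \in A) => -[].
Qed.

Lemma enum_min a A : (forall b, b \in A -> (a < b)%N) ->
  enum (a |: A) = a :: enum A.
Proof.
move=> aA; apply: (@irr_sorted_eq _ (fun b c : 'I_m => (b < c)%N)).
- by move=> b c d; apply: ltn_trans.
- by move=> b; rewrite /= ltnn.
- rewrite /enum_mem; apply: sorted_filter; first by move=> b c d; apply: ltn_trans.
  have := iota_ltn_sorted 0 m; rewrite -val_enum_ord sorted_map.
  by rewrite enumT.
- rewrite /= path_min_sorted.
    rewrite /enum_mem; apply: sorted_filter; first by move=> b c d; apply: ltn_trans.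
    have := iota_ltn_sorted 0 m; rewrite -val_enum_ord sorted_map.
    by rewrite enumT.
  by apply/allP => b; rewrite mem_enum; apply: aA.
- by move=> b; rewrite inE !mem_enum !inE.
Qed.

Lemma wedge_family_enum A (W : 'I_m -> ext R m) :
  wedge_family A W = foldr (fun a => wedge (W a)) (dx finset.set0) (enum A).
Proof.
rewrite /wedge_family unlock /reducebig /enum_mem /index_enum -enumT.
rewrite unlock; elim: (enum 'I_m) => //= a s ->.
by rewrite /applybig /=; case: ifP.
Qed.

Lemma wedge_family0 (W : 'I_m -> ext R m) :
  wedge_family finset.set0 W = dx finset.set0.
Proof. by rewrite wedge_family_enum enum_set0. Qed.

Lemma wedge_family_min a A (W : 'I_m -> ext R m) :
  (forall b, b \in A -> (a < b)%N) ->
  wedge_family (a |: A) W = wedge (W a) (wedge_family A W).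
Proof. by move=> aA; rewrite !wedge_family_enum enum_min. Qed.

Lemma wedge_family_dx A : wedge_family A (fun b => covector (delta b)) = dx A.
Proof.
elim/set_min_ind: A => [|a A aA IH]; first exact: wedge_family0.
by rewrite wedge_family_min // IH -[LHS]/(lmul _ _) lmul_delta_min.
Qed.

(** Chart changes of the torus are local translations, so this is the pullback that occurs between
    charts. *)
Lemma pullback1 u : pullback 1%:M u = u.
Proof.
rewrite [RHS]ext_sum; apply: eq_bigr => A _; congr (_ *: _).
rewrite -[RHS]wedge_family_dx; congr (wedge_family _ _).
apply/funext => b; congr covector; apply/funext => a.
by rewrite /delta !mxE; case: eqP.
Qed.

Lemma lmul_homogeneous v u k K :
  (forall A, #|A| != k -> u A = 0) -> #|K| != k.+1 -> lmul v u K = 0.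
Proof.
move=> uk Kk; rewrite lmulE; apply: big1 => a aK; rewrite uk ?mulr0 //.
by apply: contra Kk => /eqP <-; rewrite (cardsD1 a) aK.
Qed.

Lemma wedge_family_homogeneous A (W : 'I_m -> 'I_m -> R[i]) K :
  #|K| != #|A| -> wedge_family A (fun a => covector (W a)) K = 0.
Proof.
elim/set_min_ind: A K => [|a A aA IH] K.
  by rewrite wedge_family0 cards0 cards_eq0 ffunE => /negbTE->.
rewrite wedge_family_min // cardsU1 (notin_min aA) => cK.
exact: (@lmul_homogeneous (W a) _ #|A| K IH).
Qed.

End LeftMultiplication.

(** * Bidegree projections of products of covectors *)

Section Bidegree.
Context {R : realType} {m : nat} (J : 'M[R]_m).
Implicit Types (u : ext R m) (A K S : {set 'I_m}) (v w : 'I_m -> R[i]).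
Implicit Types (X : nat -> nat -> ext R m) (p q : nat) (a b : 'I_m).

Definition part10 v : 'I_m -> R[i] :=
  fun b => 2^-1 * (v b - 'i * \sum_a v a * (J b a)%:C).

Definition part01 v : 'I_m -> R[i] :=
  fun b => 2^-1 * (v b + 'i * \sum_a v a * (J b a)%:C).

(** The (p,q) component of (v + w) /\ X for v of type (1,0), w of type (0,1) and X with components
    [X p q]; the zero branches stand for negative degrees. *)
Definition graded_lmul v w X : nat -> nat -> ext R m := fun p q =>
  (if p is p'.+1 then lmul v (X p' q) else 0) +
  (if q is q'.+1 then lmul w (X p q') else 0).

Lemma sum_delta a (F : 'I_m -> R[i]) : \sum_b (b == a)%:R * F b = F a.
Proof.
by rewrite (bigD1 a) //= eqxx mul1r big1 ?addr0 // => c /negbTE->; rewrite mul0r.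
Qed.

Lemma dx10E a : dx10 J a = covector (part10 (delta a)).
Proof.
apply/ffunP => A; rewrite /dx10 !extZE extDE extNE extZE dxE !covectorE.
rewrite /part10 /delta.
under [RHS]eq_bigr => b _ do rewrite sum_delta -mulrA mulrBl -mulrA.
by rewrite -mulr_sumr sumrB -mulr_sumr sum_delta.
Qed.

Lemma dx01E a : dx01 J a = covector (part01 (delta a)).
Proof.
apply/ffunP => A; rewrite /dx01 !extZE extDE extZE dxE !covectorE.
rewrite /part01 /delta.
under [RHS]eq_bigr => b _ do rewrite sum_delta -mulrA mulrDl -mulrA.
by rewrite -mulr_sumr big_split /= -mulr_sumr sum_delta.
Qed.

Lemma ext_bidegree_sum p q (I : Type) (r : seq I) (c : I -> R[i])
    (F : I -> ext R m) :
  ext_bidegree J p q (\sum_(i <- r) c i *: F i) =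
  \sum_(i <- r) c i *: ext_bidegree J p q (F i).
Proof.
rewrite /ext_bidegree.
under eq_bigr => A _ do rewrite sum_ffunE scaler_suml.
rewrite exchange_big; apply: eq_bigr => i _; rewrite scaler_sumr.
by apply: eq_bigr => A _; rewrite extZE scalerA.
Qed.

Lemma ext_bidegreeZ p q c u :
  ext_bidegree J p q (c *: u) = c *: ext_bidegree J p q u.
Proof.
have := ext_bidegree_sum p q [:: tt] (fun=> c) (fun=> u).
by rewrite !big_seq1.
Qed.

Lemma ext_bidegree_dx p q A :
  ext_bidegree J p q (dx A) =
  \sum_(S : {set 'I_m} | [&& S \subset A, #|S| == p & #|A :\: S| == q])
    wedge_family A (fun a => if a \in S then dx10 J a else dx01 J a).
Proof.
rewrite /ext_bidegree (bigD1 A) //= dxE eqxx scale1r [X in _ + X]big1 ?addr0 // => B.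
by move=> /negbTE BA; rewrite dxE BA scale0r.
Qed.

Lemma ext_bidegree0 p q :
  ext_bidegree J p q (dx finset.set0) =
  ((p == 0%N) && (q == 0%N))%:R *: dx finset.set0.
Proof.
rewrite ext_bidegree_dx (eq_bigl (fun S : {set 'I_m} =>
  (S == finset.set0) && ((p == 0%N) && (q == 0%N)))); last first.
  move=> S; rewrite finset.subset0; case: eqP => //= ->.
  by rewrite finset.setD0 cards0 ![0%N == _]eq_sym.
case: (_ && _); last by rewrite big_pred0 ?scale0r // => S; rewrite andbF.
rewrite (eq_bigl (pred1 finset.set0)); last by move=> S; rewrite andbT.
by rewrite big_pred1_eq wedge_family0 scale1r.
Qed.

Lemma eq_wedge_family A (W W' : 'I_m -> ext R m) :
  {in A, W =1 W'} -> wedge_family A W = wedge_family A W'.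
Proof.
move=> WW'; rewrite !wedge_family_enum.
have : {subset enum A <= A} by move=> a; rewrite mem_enum.
elim: (enum A) => //= a s IH sA; rewrite IH.
  by rewrite WW' // sA ?mem_head.
by move=> b bs; rewrite sA // inE bs orbT.
Qed.

(** In the sum over S, the sets containing a take the (1,0) part of dx_a and lower p; the others
    take its (0,1) part and lower q. *)
Lemma ext_bidegree_min p q a A : (forall b, b \in A -> (a < b)%N) ->
  ext_bidegree J p q (dx (a |: A)) =
  graded_lmul (part10 (delta a)) (part01 (delta a))
    (fun p q => ext_bidegree J p q (dx A)) p q.
Proof.
move=> aA; have aNA := notin_min aA.
rewrite ext_bidegree_dx (bigID (fun S : {set 'I_m} => a \in S)) /=.
congr (_ + _).
  case: p => [|p].
    apply: big1 => S /andP[/and3P[_]]; rewrite cards_eq0 => /eqP-> _.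
    by rewrite inE.
  rewrite (reindex_onto (fun S : {set 'I_m} => a |: S) (fun S => S :\ a)) /=; last first.
    by move=> S /andP[_ aS]; rewrite finset.setD1K.
  rewrite ext_bidegree_dx lmul_sumr [RHS]big_mkcond [LHS]big_mkcond.
  apply: eq_bigr => S _; rewrite finset.setU11 andbT.
  have [aS|aS] := boolP (a \in S).
    rewrite [in RHS]ifF; last first.
      by apply/negP => /and3P[/fintype.subsetP/(_ a aS)]; rewrite (negbTE aNA).
    rewrite ifF //; apply/negP => /andP[_ /eqP SE].
    by move: aS; rewrite -SE !inE eqxx.
  rewrite finset.setU1K // eqxx andbT cardsU1 aS.
  have -> : (a |: S \subset a |: A) = (S \subset A).
    apply/fintype.subsetP/fintype.subsetP => SA b bS.
      have := SA b; rewrite !inE bS orbT => /(_ isT)/orP[/eqP ba|//].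
      by rewrite -ba bS in aS.
    by move: bS; rewrite !inE => /orP[->//|/SA->]; rewrite orbT.
  have -> : (a |: A) :\: (a |: S) = A :\: S.
    apply/setP => b; rewrite !inE negb_or.
    by case: eqVneq => [->|]; rewrite ?(negbTE aNA) ?andbF.
  rewrite add1n eqSS; case: ifP => // _.
  rewrite wedge_family_min // finset.setU11 dx10E /lmul; congr wedge.
  apply: eq_wedge_family => b bA; rewrite !inE.
  by case: eqP => // ba; rewrite -ba bA in aNA.
case: q => [|q].
  apply: big1 => S /andP[/and3P[_ _]]; rewrite cards_eq0 finset.setD_eq0.
  by move=> /fintype.subsetP/(_ a (finset.setU11 _ _))->.
rewrite ext_bidegree_dx lmul_sumr [RHS]big_mkcond [LHS]big_mkcond.
apply: eq_bigr => S _; have [aS|aS] := boolP (a \in S).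
  rewrite andbF ifF //.
  by apply/negP => /and3P[/fintype.subsetP/(_ a aS)]; rewrite (negbTE aNA).
rewrite andbT.
have -> : (S \subset a |: A) = (S \subset A).
  apply/fintype.subsetP/fintype.subsetP => SA b bS.
    have := SA b; rewrite !inE bS => /(_ isT)/orP[/eqP ba|//].
    by rewrite -ba bS in aS.
  by rewrite !inE SA ?orbT.
have -> : (a |: A) :\: S = a |: (A :\: S).
  by apply/setP => b; rewrite !inE; case: eqVneq => [->|]; rewrite ?aS.
rewrite cardsU1 !inE (negbTE aNA) andbF.
rewrite add1n eqSS; case: ifP => // _.
by rewrite wedge_family_min // (negbTE aS) dx01E.
Qed.

Lemma graded_lmulC v v' w w' X p q :
  graded_lmul v v' (graded_lmul w w' X) p q =
  - graded_lmul w w' (graded_lmul v v' X) p q.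
Proof.
rewrite /graded_lmul; case: p => [|p]; case: q => [|q];
  rewrite ?(add0r, addr0, oppr0) //.
- case: q => [|q]; rewrite ?(add0r, lmul0r, oppr0) //; exact: lmulC.
- case: p => [|p]; rewrite ?(addr0, lmul0r, oppr0) //; exact: lmulC.
rewrite !lmulDr (lmulC w v') (lmulC w' v) !opprD !opprK addrACA.
congr (_ + _ + (_ + _)).
- by case: p => [|p]; [rewrite !lmul0r oppr0|exact: lmulC].
- by case: q => [|q]; [rewrite !lmul0r oppr0|exact: lmulC].
Qed.

Lemma ext_bidegreeN p q u : ext_bidegree J p q (- u) = - ext_bidegree J p q u.
Proof. by rewrite -[in LHS]scaleN1r ext_bidegreeZ scaleN1r. Qed.

Lemma ext_bidegree_zero p q : ext_bidegree J p q 0 = 0.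
Proof. by have := ext_bidegreeZ p q 0 0; rewrite !scale0r. Qed.

Lemma graded_lmulZ v w X c p q :
  graded_lmul v w (fun p q => c *: X p q) p q = c *: graded_lmul v w X p q.
Proof.
rewrite /graded_lmul scalerDr.
by congr (_ + _); [case: p => [|k]|case: q => [|k]]; rewrite ?scaler0 ?lmulZr.
Qed.

Lemma graded_lmul_sumr v w (I : Type) (r : seq I) (c : I -> R[i])
    (F : I -> nat -> nat -> ext R m) p q :
  graded_lmul v w (fun p q => \sum_(i <- r) c i *: F i p q) p q =
  \sum_(i <- r) c i *: graded_lmul v w (F i) p q.
Proof.
rewrite /graded_lmul; under [RHS]eq_bigr => i _ do rewrite scalerDr.
rewrite big_split /=; congr (_ + _); [case: p => [|k]|case: q => [|k]];
  rewrite ?lmul_sumr; under [RHS]eq_bigr => i _ do rewrite ?scaler0 -?lmulZr //;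
  by rewrite // big1.
Qed.

Lemma eq_graded_lmul v w X X' p q : (forall p q, X p q = X' p q) ->
  graded_lmul v w X p q = graded_lmul v w X' p q.
Proof.
by move=> XX'; rewrite /graded_lmul; congr (_ + _); [case: p => [|k]|case: q => [|k]];
  rewrite ?XX'.
Qed.

Lemma graded_lmul_sqr v w X p q : graded_lmul v w (graded_lmul v w X) p q = 0.
Proof.
have /eqP := graded_lmulC v w v w X p q.
by rewrite -subr_eq0 opprK -mulr2n -scaler_nat scaler_eq0 pnatr_eq0 => /eqP.
Qed.

(** Extends [ext_bidegree_min] to any position of a. If the least element b of the set is below a,
    it is moved to the front by anticommutation on both sides; if a = b, both sides are squares,
    hence 0. *)
Lemma ext_bidegree_lmul_delta p q a A :
  ext_bidegree J p q (lmul (delta a) (dx A)) =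
  graded_lmul (part10 (delta a)) (part01 (delta a))
    (fun p q => ext_bidegree J p q (dx A)) p q.
Proof.
elim/(@set_min_ind m): A a p q => [|b A bA IH] a p q.
  have a0 : forall b, b \in (finset.set0 : {set 'I_m}) -> (a < b)%N.
    by move=> b; rewrite inE.
  by rewrite lmul_delta_min // ext_bidegree_min.
have [lt_ab|lt_ba|/val_inj ab] := ltngtP a b.
- have abA c : c \in b |: A -> (a < c)%N.
    by rewrite !inE => /orP[/eqP->//|/bA]; apply: ltn_trans.
  by rewrite lmul_delta_min // ext_bidegree_min.
- rewrite -(lmul_delta_min bA) lmulC ext_bidegreeN.
  transitivity (- graded_lmul (part10 (delta b)) (part01 (delta b))
    (fun p q => ext_bidegree J p q (lmul (delta a) (dx A))) p q).
    congr (- _); rewrite lmul_delta_dx; case: ifPn => aA.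
      rewrite lmul0r ext_bidegree_zero /graded_lmul.
      by case: p => [|p]; case: q => [|q]; rewrite ?ext_bidegree_zero ?lmul0r addr0.
    have baA c : c \in a |: A -> (b < c)%N.
      by rewrite !inE => /orP[/eqP->//|/bA].
    rewrite lmulZr ext_bidegreeZ lmul_delta_min // ext_bidegree_min //.
    rewrite -graded_lmulZ; apply: eq_graded_lmul => p' q'.
    by rewrite ext_bidegreeZ.
  under eq_graded_lmul do rewrite IH.
  rewrite -graded_lmulC; apply: eq_graded_lmul => p' q'.
  by rewrite lmul_delta_min // ext_bidegree_min.
rewrite -ab -{1}(lmul_delta_min (a := a) (A := A)) ?lmul_sqr; last by rewrite ab.
rewrite ext_bidegree_zero -[LHS](graded_lmul_sqr (part10 (delta a))
  (part01 (delta a)) (fun p q => ext_bidegree J p q (dx A)) p q).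
by apply: eq_graded_lmul => p' q'; rewrite ext_bidegree_min // ab.
Qed.

Lemma covector_sum_delta v : v = fun b => \sum_a v a * delta a b.
Proof.
apply/funext => b; rewrite (bigD1 b) //= /delta eqxx mulr1 big1 ?addr0 // => c.
by rewrite eq_sym => /negbTE->; rewrite mulr0.
Qed.

Lemma part10_sum v : part10 v = fun b => \sum_a v a * part10 (delta a) b.
Proof.
apply/funext => b; rewrite /part10 {1}(covector_sum_delta v).
rewrite mulrBr !mulr_sumr -sumrB; apply: eq_bigr => a _.
by rewrite sum_delta; ring.
Qed.

Lemma part01_sum v : part01 v = fun b => \sum_a v a * part01 (delta a) b.
Proof.
apply/funext => b; rewrite /part01 {1}(covector_sum_delta v).
rewrite mulrDr !mulr_sumr -big_split; apply: eq_bigr => a _ /=.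
by rewrite sum_delta; ring.
Qed.

(** Both sides are linear in v and in u, so basis elements suffice. Products of (1,0) and (0,1)
    covectors can then be projected without expanding them in the dx_A. *)
Lemma ext_bidegree_lmul p q v u :
  ext_bidegree J p q (lmul v u) =
  graded_lmul (part10 v) (part01 v) (fun p q => ext_bidegree J p q u) p q.
Proof.
rewrite {1}(ext_sum u) lmul_sumr.
under eq_bigr => A _ do rewrite lmulZr.
rewrite ext_bidegree_sum.
transitivity (graded_lmul (part10 v) (part01 v)
  (fun p q => \sum_A u A *: ext_bidegree J p q (dx A)) p q); last first.
  by apply: eq_graded_lmul => p' q'; rewrite -ext_bidegree_sum -ext_sum.
rewrite graded_lmul_sumr; apply: eq_bigr => A _; congr (_ *: _).
rewrite {1}(covector_sum_delta v) lmul_suml ext_bidegree_sum.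
under eq_bigr => a _ do rewrite ext_bidegree_lmul_delta.
rewrite (part10_sum v) (part01_sum v) /graded_lmul.
under [LHS]eq_bigr => a _ do rewrite scalerDr.
rewrite big_split /=; congr (_ + _); [case: p => [|k]|case: q => [|k]];
  rewrite ?lmul_suml //; by apply: big1 => a _; rewrite scaler0.
Qed.

(** Needed for the unknown forms in a Lefschetz sum, whose degree is known only through their
    bidegree. *)
Lemma ext_bidegree_homogeneous p q u K :
  #|K| != (p + q)%N -> ext_bidegree J p q u K = 0.
Proof.
move=> cK; rewrite sum_ffunE big1 // => A _; rewrite extZE sum_ffunE.
rewrite big1 ?mulr0 // => S /and3P[SA /eqP cS /eqP cAS].
have cA : #|A| = (p + q)%N.
  by rewrite -cS -cAS -(cardsID S A) (finset.setIidPr SA).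
pose W a := if a \in S then part10 (delta a) else part01 (delta a).
rewrite (eq_wedge_family (W' := fun a => covector (W a))) => [|a _].
  by apply: wedge_family_homogeneous; rewrite cA.
by rewrite /W; case: ifP => _; rewrite (dx10E, dx01E).
Qed.

End Bidegree.

(** * Coordinates in pairs *)

Section Pairs.
Context {n : nat}.
Implicit Types (j : 'I_n) (a b : 'I_(n.*2)) (A B K : {set 'I_(n.*2)}).

Fact xidx_subproof j : (j.*2 < n.*2)%N. Proof. by rewrite ltn_double. Qed.
Fact yidx_subproof j : (j.*2.+1 < n.*2)%N. Proof. by rewrite ltn_Sdouble. Qed.
Fact pidx_subproof a : (a./2 < n)%N. Proof. by rewrite ltn_half_double. Qed.

Definition xidx j : 'I_(n.*2) := Ordinal (xidx_subproof j).
Definition yidx j : 'I_(n.*2) := Ordinal (yidx_subproof j).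
Definition pidx a : 'I_n := Ordinal (pidx_subproof a).
Definition flip a : 'I_(n.*2) := if odd a then xidx (pidx a) else yidx (pidx a).

Lemma pidx_x j : pidx (xidx j) = j.
Proof. by apply: val_inj; rewrite /= doubleK. Qed.

Lemma pidx_y j : pidx (yidx j) = j.
Proof. by apply: val_inj; rewrite /= uphalf_double. Qed.

Variant idx_spec a : 'I_(n.*2) -> bool -> 'I_n -> Type :=
| IdxX j of a = xidx j : idx_spec a (xidx j) false j
| IdxY j of a = yidx j : idx_spec a (yidx j) true j.

Lemma idxP a : idx_spec a a (odd a) (pidx a).
Proof.
have := odd_double_half a; case: (boolP (odd a)) => oa /= aE.
  have aY : a = yidx (pidx a) by apply: val_inj; rewrite /= -[LHS]aE.
  by rewrite {2}aY; constructor.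
have aX : a = xidx (pidx a) by apply: val_inj; rewrite /= -[LHS]aE.
by rewrite {2}aX; constructor.
Qed.

Lemma flip_x j : flip (xidx j) = yidx j.
Proof. by rewrite /flip /= odd_double pidx_x. Qed.

Lemma flip_y j : flip (yidx j) = xidx j.
Proof. by rewrite /flip /= odd_double pidx_y. Qed.

Lemma flipK : involutive flip.
Proof. by move=> a; case: (idxP a) => j _; rewrite ?flip_x ?flip_y ?flip_x. Qed.

Lemma xy_eq i j : (xidx i == yidx j) = false.
Proof.
by apply/negP => /eqP/(congr1 (fun a => odd (val a))); rewrite /= !odd_double.
Qed.

Lemma yx_eq i j : (yidx i == xidx j) = false.
Proof. by rewrite eq_sym xy_eq. Qed.

Lemma xx_eq i j : (xidx i == xidx j) = (i == j).
Proof. by apply/eqP/eqP => [/(congr1 pidx)|->//]; rewrite !pidx_x. Qed.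

Lemma yy_eq i j : (yidx i == yidx j) = (i == j).
Proof. by apply/eqP/eqP => [/(congr1 pidx)|->//]; rewrite !pidx_y. Qed.

Definition idx_eqE := (xy_eq, yx_eq, xx_eq, yy_eq).

Lemma big_pairs (T : Type) (idx : T) (op : Monoid.com_law idx)
    (F : 'I_(n.*2) -> T) :
  \big[op/idx]_a F a = \big[op/idx]_j op (F (xidx j)) (F (yidx j)).
Proof.
pose h (jb : 'I_n * bool) := if jb.2 then yidx jb.1 else xidx jb.1.
rewrite (reindex h) /=; last first.
  exists (fun a => (pidx a, odd a)) => [[j []]|a] _; rewrite /h /=.
  - by rewrite pidx_y odd_double.
  - by rewrite pidx_x odd_double.
  by case: (idxP a).
under [RHS]eq_bigr => j _ do rewrite -[F (xidx j)]/(F (h (j, false)))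
  -[F (yidx j)]/(F (h (j, true))).
transitivity (\big[op/idx]_j \big[op/idx]_b F (h (j, b))).
  by rewrite pair_big; apply: eq_bigr => -[].
by apply: eq_bigr => j _; rewrite big_bool Monoid.mulmC.
Qed.

Definition pairset j : {set 'I_(n.*2)} := [set xidx j; yidx j].

Lemma in_pairset a j : (a \in pairset j) = (pidx a == j).
Proof.
rewrite !inE; case: (idxP a) => i _; rewrite ?idx_eqE ?orbF //.
Qed.

Lemma xy_lt i j : (xidx i < yidx j)%N = (i <= j)%N.
Proof. by rewrite /= ltnS leq_double. Qed.

Lemma yx_lt i j : (yidx i < xidx j)%N = (i < j)%N.
Proof. by rewrite /= ltn_Sdouble. Qed.

Lemma xx_lt i j : (xidx i < xidx j)%N = (i < j)%N.
Proof. by rewrite /= ltn_double. Qed.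

Lemma yy_lt i j : (yidx i < yidx j)%N = (i < j)%N.
Proof. by rewrite /= ltnS ltn_double. Qed.

Definition idx_ltE := (xy_lt, yx_lt, xx_lt, yy_lt).

Lemma pairset_sub j K : (pairset j \subset K) = (xidx j \in K) && (yidx j \in K).
Proof. by rewrite finset.subUset !finset.sub1set. Qed.

Lemma eq_set_pairs A B :
  (forall j, (xidx j \in A) = (xidx j \in B)) ->
  (forall j, (yidx j \in A) = (yidx j \in B)) -> A = B.
Proof. by move=> hx hy; apply/setP => a; case: (idxP a). Qed.

Lemma card_pairs A : #|A| = (\sum_j ((xidx j \in A) + (yidx j \in A)))%N.
Proof. by rewrite -sum1_card big_mkcond big_pairs; apply: eq_bigr => j _; do 2 case: ifP. Qed.

End Pairs.

Section Tensor.
Context {R : realType} {n : nat}.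
Implicit Types (j : 'I_n) (a : 'I_(n.*2)) (A B K : {set 'I_(n.*2)}).
Implicit Types (f : 'I_n -> bool -> bool -> R[i]) (g : bool -> bool -> R[i]).

(* Since the two coordinates of a pair are consecutive, a wedge product of forms
   supported on the successive pairs has coefficients that are plain products,
   without signs. *)
Definition tensor f : ext R n.*2 :=
  [ffun A : {set 'I_(n.*2)} => \prod_j f j (xidx j \in A) (yidx j \in A)].

Lemma tensorE f A : tensor f A = \prod_j f j (xidx j \in A) (yidx j \in A).
Proof. by rewrite ffunE. Qed.

Definition one_at : bool -> bool -> R[i] := fun b b' => (~~ b && ~~ b')%:R.

Definition update f j g : 'I_n -> bool -> bool -> R[i] :=
  fun i => if i == j then g else f i.

(** Left multiplication by vx dx_j + vy dy_j in the four coefficients of one pair; [(-1) ^+ b] is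
    the sign of moving dy_j past dx_j. *)
Definition local_lmul (vx vy : R[i]) g : bool -> bool -> R[i] := fun b b' =>
  b%:R * vx * g false b' + b'%:R * (-1) ^+ b * vy * g b false.

Lemma tensor_one : tensor (fun=> one_at) = dx finset.set0.
Proof.
apply/ffunP => A; rewrite tensorE dxE.
case: (finset.set_0Vmem A) => [->|[a aA]].
  by rewrite eqxx big1 // => j _; rewrite !inE.
have -> : (A == finset.set0) = false by apply/negbTE/finset.set0Pn; exists a.
rewrite (bigD1 (pidx a)) //=; move: aA.
by case: (idxP a) => j _ ->; rewrite /one_at ?andbF /= mul0r.
Qed.

Lemma below_x j K : below (xidx j) K =
  (\sum_(i < n | (i < j)%N) ((xidx i \in K) + (yidx i \in K)))%N.
Proof.
rewrite /below -sum1_card big_mkcond big_pairs [RHS]big_mkcond.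
apply: eq_bigr => i _; rewrite !inE !idx_ltE.
by do 2 case: (_ \in K); case: (_ < _)%N.
Qed.

Lemma below_y j K : below (yidx j) K = (below (xidx j) K + (xidx j \in K))%N.
Proof.
rewrite below_x /below -sum1_card big_mkcond big_pairs (bigD1 j) //=.
rewrite addnC [in RHS]big_mkcond [in RHS](bigD1 j) //= ltnn add0n; congr (_ + _)%N.
  apply: eq_bigr => i ij; rewrite !inE !idx_ltE leq_eqVlt -[(_ == _ :> nat)]/(i == j).
  by rewrite (negbTE ij); do 2 case: (_ \in K); case: (_ < _)%N.
by rewrite !inE !idx_ltE leqnn ltnn andbT andbF addn0; case: (_ \in K).
Qed.

(** Since the factors of the earlier pairs are 1, the 1-form passes no coordinate outside pair j,
    and the only sign is the local one. *)
Lemma lmul_tensor j vx vy f (v : 'I_(n.*2) -> R[i]) :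
  v (xidx j) = vx -> v (yidx j) = vy -> (forall a, pidx a != j -> v a = 0) ->
  (forall i : 'I_n, (i < j)%N -> f i = one_at) ->
  lmul v (tensor f) = tensor (update f j (local_lmul vx vy (f j))).
Proof.
move=> vxE vyE v0 f1; apply/ffunP => K; rewrite lmulE big_mkcond big_pairs.
rewrite (bigD1 j) //= [X in _ + X]big1 => [|i ij]; last first.
  by rewrite !v0 ?pidx_x ?pidx_y // !mulr0 !mul0r !if_same addr0.
rewrite addr0 vxE vyE !tensorE !(bigD1 j (P := xpredT)) //= !inE !idx_eqE !eqxx /=.
set P := \prod_(i | i != j) f i (xidx i \in K) (yidx i \in K).
have PE c : pidx c = j -> \prod_(i | i != j) f i (xidx i \in K :\ c) (yidx i \in K :\ c) = P.
  move=> cj; apply: eq_bigr => i ij; rewrite !inE.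
  have -> : (xidx i != c) by apply: contraNneq ij => ic; rewrite -cj -ic pidx_x.
  have -> : (yidx i != c) by apply: contraNneq ij => ic; rewrite -cj -ic pidx_y.
  by [].
rewrite !PE ?pidx_x ?pidx_y // /update eqxx.
have -> : \prod_(i | i != j) (if i == j then local_lmul vx vy (f j) else f i)
    (xidx i \in K) (yidx i \in K) = P.
  by apply: eq_bigr => i /negbTE->.
(* If K meets a pair before j, the factor [one_at] of that pair makes both sides vanish. *)
have [/existsP[i /andP[ij iK]]|] :=
  boolP [exists i : 'I_n, (i < j)%N && ((xidx i \in K) || (yidx i \in K))].
  have -> : P = 0.
    rewrite /P (bigD1 i) /=; last by apply: contraTneq ij => ->; rewrite ltnn.
    by rewrite f1 // /one_at -negb_or iK mul0r.
  by rewrite !mulr0 !if_same addr0.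
rewrite negb_exists => /forallP low.
have bx : below (xidx j) K = 0%N.
  rewrite below_x big1 // => i ij; move: (low i); rewrite ij /= negb_or.
  by move=> /andP[/negbTE-> /negbTE->].
rewrite below_y bx add0n expr0 /local_lmul; set bX := xidx j \in K.
by case: (bX); case: (_ \in K); rewrite /= ?expr0 ?expr1; ring.
Qed.

End Tensor.

(** * Orthonormal coframes *)

Section Frame.
Context {R : realType} {n : nat}.
Implicit Types (j : 'I_n) (a b : 'I_(n.*2)) (A B K : {set 'I_(n.*2)}).
Implicit Types (u v : ext R n.*2) (w : 'I_(n.*2) -> R).

(** The vectors E_a = e_a / w_a are orthonormal for [frame_g], and J sends E_x to E_y and E_y to -
    E_x in each pair. *)
Definition frame_J w : 'M[R]_(n.*2) :=
  \matrix_(a, b) if b == flip a then (-1) ^+ odd a * w a / w b else 0.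

Definition frame_g w : 'M[R]_(n.*2) := diag_mx (\row_a w a ^+ 2).

(** Under w_x w_y = 1 the form omega is the sum of the dx_j dy_j whatever the weights are, so
    varying them with the point keeps omega constant. *)
Definition unimodular w := (forall a, 0 < w a) /\
  forall j, w (xidx j) * w (yidx j) = 1.

Lemma sum_if_eq (V : nmodType) (I : finType) (c : I) (F : I -> V) :
  \sum_i (if i == c then F i else 0) = F c.
Proof. by rewrite -big_mkcond big_pred1_eq. Qed.

Lemma odd_flip a : odd (flip a) = ~~ odd a.
Proof. by case: (idxP a) => j _; rewrite ?flip_x ?flip_y /= ?odd_double. Qed.

Lemma frame_J_sqr w : unimodular w -> frame_J w *m frame_J w = - 1%:M.
Proof.
move=> [w_gt0 _]; apply/matrixP => a b; rewrite !mxE.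
under eq_bigr => c _ do rewrite !mxE.
rewrite (eq_bigr (fun c => if c == flip a then
  (-1) ^+ odd a * w a / w c * (if b == flip c then (-1) ^+ odd c * w c / w b else 0)
  else 0)); last by move=> c _; case: eqP => // _; rewrite mul0r.
rewrite sum_if_eq flipK eq_sym; case: eqP => [->|_]; last by rewrite mulr0 mulr0n oppr0.
have wa c : w c != 0 by rewrite gt_eqF.
rewrite odd_flip /= mulr1n; case: (odd b); rewrite ?expr0 ?expr1;
by field; rewrite !wa.
Qed.

Lemma frame_g_sym w : (frame_g w)^T = frame_g w.
Proof. exact: tr_diag_mx. Qed.

Lemma frame_g_pos w : unimodular w -> forall v : 'rV[R]_(n.*2), v != 0 ->
  0 < (v *m frame_g w *m v^T) 0 0.
Proof.
move=> [w_gt0 _] v /rV0Pn[a va]; rewrite mul_mx_diag mxE.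
under eq_bigr => b _ do rewrite !mxE.
rewrite (bigD1 a) //= ltr_pwDl //.
  by rewrite mulrAC -expr2 mulr_gt0 // exprn_even_gt0 //= gt_eqF.
by apply: sumr_ge0 => b _; rewrite mulrAC -expr2 mulr_ge0 ?sqr_ge0.
Qed.

Lemma frame_Jg w a b : unimodular w ->
  (frame_J w *m frame_g w) a b = if b == flip a then (-1) ^+ odd a else 0.
Proof.
move=> [w_gt0 wxy]; rewrite mul_mx_diag !mxE.
case: eqP => [->|_]; last by rewrite mul0r.
have wf : w a * w (flip a) = 1.
  by case: (idxP a) => j _; rewrite ?flip_x ?flip_y ?[w (yidx _) * _]mulrC wxy.
rewrite expr2 -!mulrA [_^-1 * _]mulrA mulVf ?gt_eqF // mul1r.
by rewrite [X in _ * X]wf mulr1.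
Qed.

Lemma frame_g_J w : unimodular w ->
  frame_J w *m frame_g w *m (frame_J w)^T = frame_g w.
Proof.
move=> uw; have [w_gt0 wxy] := uw; apply/matrixP => a b; rewrite mxE.
under eq_bigr => c _ do rewrite frame_Jg // [(_^T) _ _]mxE.
rewrite (eq_bigr (fun c => if c == flip a then (-1) ^+ odd a * frame_J w b c else 0));
  last by move=> c _; case: eqP => // _; rewrite mul0r.
rewrite sum_if_eq !mxE (can_eq flipK) eq_sym; case: eqP => [->|_]; last by rewrite mulr0 mulr0n.
rewrite mulr1n -!mulrA [LHS]mulrA -expr2 sqrr_sign mul1r.
have wf : w a * w (flip a) = 1.
  by case: (idxP a) => j _; rewrite ?flip_x ?flip_y ?[w (yidx _) * _]mulrC wxy.
have w0 : w (flip a) != 0 by rewrite gt_eqF.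
by apply: (mulIf w0); rewrite divfK // expr2 -mulrA wf mulr1.
Qed.

Lemma invmx_frame_g w : unimodular w ->
  invmx (frame_g w) = diag_mx (\row_a (w a) ^- 2).
Proof.
move=> [w_gt0 _].
have E : diag_mx (\row_a (w a) ^- 2) *m frame_g w = 1%:M.
  rewrite mulmx_diag -diag_const_mx; congr diag_mx; apply/rowP => a.
  by rewrite !mxE mulVf // expf_neq0 // gt_eqF.
have [gu _] := mulmx1_unit (mulmx1C E).
by rewrite -[LHS]mul1mx -E mulmxK.
Qed.

Lemma gram_frame w A B : unimodular w ->
  gram (frame_g w) A B = (A == B)%:R * \prod_(a in A) (w a) ^- 2.
Proof.
move=> uw; rewrite /gram invmx_frame_g //; case: (eqVneq A B) => [<-|AB].
  rewrite eqxx mul1r [RHS]big_enum_val.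
  have -> : (\matrix_(i < #|A|, j < #|A|) diag_mx (\row_a (w a) ^- 2)
     (enum_val i) (nth (enum_val i) (enum A) j)) =
     diag_mx (\row_(i < #|A|) (w (enum_val i)) ^- 2).
    apply/matrixP => i j; rewrite !mxE -enum_val_nth.
    by rewrite (inj_eq enum_val_inj).
  by rewrite det_diag; apply: eq_bigr => i _; rewrite mxE.
rewrite mul0r; case: eqP => // cAB.
(* For distinct A and B of equal size, the row of the Gram matrix at such an a vanishes. *)
have [a aA aB] : exists2 a, a \in A & a \notin B.
  apply/fintype.subsetPn; apply: contra AB => AB; rewrite finset.eqEcard AB.
  by rewrite cAB leqnn.
rewrite (expand_det_row _ (enum_rank_in aA a)) big1 // => j _.
rewrite !mxE enum_rankK_in //.
have jB : (nth a (enum B) j) \in B.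
  by rewrite -mem_enum mem_nth // -cardE -cAB.
case: eqP => [aE|_]; last by rewrite mul0r.
by rewrite aE jB in aB.
Qed.

End Frame.

(** * Lefschetz operators *)

Section Lefschetz.
Context {R : realType} {n : nat}.
Implicit Types (i j : 'I_n) (a b : 'I_(n.*2)) (A B K M : {set 'I_(n.*2)}).
Implicit Types (u v : ext R n.*2) (w : 'I_(n.*2) -> R).

Lemma shuffle_signE A B :
  shuffle_sign A B = \prod_(a in A) (-1) ^+ below a B :> R[i].
Proof.
rewrite /shuffle_sign.
rewrite -(big_morph _ (exprD (-1 : R[i])) (expr0 _)); congr (_ ^+ _).
rewrite -sum1_card (eq_bigl (fun ab : 'I_(n.*2) * 'I_(n.*2) =>
  (ab.1 \in A) && ((ab.2 \in B) && (ab.2 < ab.1)%N))) //.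
rewrite -(pair_big_dep (fun a => a \in A) (fun a b => (b \in B) && (b < a)%N)
  (fun _ _ => 1%N)) /=.
by apply: eq_bigr => a _; rewrite sum1_card.
Qed.

Lemma wedge_dxl A u K : wedge (dx A) u K =
  if A \subset K then shuffle_sign A (K :\: A) * u (K :\: A) else 0.
Proof.
rewrite ffunE; case: ifPn => AK.
  rewrite (bigD1 A) //= dxE eqxx mulr1 big1 ?addr0 // => B /andP[_ BA].
  by rewrite dxE (negbTE BA) mulr0 mul0r.
apply: big1 => B BK; rewrite dxE; case: eqP => [BA|_].
  by rewrite -BA BK in AK.
by rewrite mulr0 mul0r.
Qed.

Lemma wedge_suml (I : Type) (r : seq I) (F : I -> ext R n.*2) u :
  wedge (\sum_(i <- r) F i) u = \sum_(i <- r) wedge (F i) u.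
Proof.
apply/ffunP => K; rewrite sum_ffunE ffunE.
under [RHS]eq_bigr => i _ do rewrite ffunE.
rewrite exchange_big; apply: eq_bigr => A _ /=.
by rewrite sum_ffunE mulr_sumr mulr_suml.
Qed.

(** No sign appears because dx_j dy_j has even degree and consecutive indices. *)
Definition lef u : ext R n.*2 :=
  [ffun K : {set 'I_(n.*2)} =>
     \sum_j if pairset j \subset K then u (K :\: pairset j) else 0].

(** This is Lambda in coordinates: by [lef_star], the star intertwines it with [lef]. *)
Definition dlef u : ext R n.*2 :=
  [ffun K : {set 'I_(n.*2)} =>
     \sum_j if pairset j \subset ~: K then u (K :|: pairset j) else 0].

Lemma shuffle_sign_pair j K : pairset j \subset K ->
  shuffle_sign (pairset j) (K :\: pairset j) = 1 :> R[i].
Proof.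
move=> jK; rewrite shuffle_signE big_mkcond big_pairs (bigD1 j) //=.
rewrite big1 ?mulr1 => [|i ij]; last by rewrite !in_pairset pidx_x pidx_y (negbTE ij) mulr1.
rewrite !in_pairset pidx_x pidx_y eqxx below_y !inE eqxx addn0.
by rewrite -expr2 sqrr_sign.
Qed.

Lemma dx1E a : dx [set a] = covector (delta a) :> ext R n.*2.
Proof.
apply/ffunP => K; rewrite covectorE dxE.
under eq_bigr => b _ do rewrite /delta.
by rewrite sum_delta.
Qed.

(** The double sum meets each pair twice, in the two orders, with equal contributions; this absorbs
    the factor 1/2. *)
Lemma ext_omega_frame w : unimodular w ->
  ext_omega (frame_J w) (frame_g w) = \sum_j dx (pairset j).
Proof.
move=> uw; rewrite /ext_omega.
have E a : \sum_b ((frame_J w *m frame_g w) a b)%:C *: wedge (dx [set a]) (dx [set b])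
   = (-1) ^+ odd a *: lmul (delta a) (dx [set flip a]).
  rewrite (eq_bigr (fun b => if b == flip a then
    (-1) ^+ odd a *: lmul (delta a) (dx [set b]) else 0)).
    by rewrite sum_if_eq.
  move=> b _; rewrite frame_Jg //; case: eqP => _; last by rewrite scale0r.
  by rewrite rmorphXn rmorphN1 /lmul -dx1E.
under eq_bigr => a _ do rewrite E.
rewrite big_pairs scaler_sumr; apply: eq_bigr => j _.
rewrite !flip_x !flip_y /= !odd_double expr0 expr1 !lmul_delta_dx !inE !idx_eqE.
have -> : below (xidx j) [set yidx j] = 0%N.
  by apply: fintype.eq_card0 => b; rewrite !inE; case: eqP => // ->; rewrite !idx_ltE ltnn.
have -> : below (yidx j) [set xidx j] = 1%N.
  rewrite /below -(cards1 (xidx j)); apply: fintype.eq_card => b; rewrite !inE.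
  by case: eqP => // ->; rewrite !idx_ltE leqnn.
rewrite expr0 expr1 !scale1r !scaleN1r opprK.
have -> : yidx j |: [set xidx j] = pairset j by rewrite finset.setUC.
by rewrite -[X in X + _]/(dx (pairset j)); apply/ffunP => K; rewrite extZE extDE; field.
Qed.

Lemma wedge_omega w u : unimodular w ->
  wedge (ext_omega (frame_J w) (frame_g w)) u = lef u.
Proof.
move=> uw; rewrite ext_omega_frame // wedge_suml; apply/ffunP => K.
rewrite sum_ffunE ffunE; apply: eq_bigr => j _; rewrite wedge_dxl.
by case: ifP => // jK; rewrite shuffle_sign_pair ?mul1r.
Qed.

Lemma omega_lef w : unimodular w ->
  ext_omega (frame_J w) (frame_g w) = lef (dx finset.set0).
Proof.
move=> uw; rewrite ext_omega_frame //; apply/ffunP => K.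
rewrite sum_ffunE ffunE; apply: eq_bigr => j _; rewrite !dxE.
case: ifPn => jK.
  rewrite finset.setD_eq0; congr (_%:R); congr nat_of_bool.
  by apply/eqP/idP => [->//|Kj]; apply/eqP; rewrite finset.eqEsubset jK Kj.
by case: eqP => // KE; rewrite KE subxx in jK.
Qed.

Definition paired K := [forall j, (xidx j \in K) == (yidx j \in K)].

Lemma card_paired K : paired K -> #|K| = (#|[pred j | pairset j \subset K]|).*2.
Proof.
move=> /forallP pK; rewrite card_pairs -(sum1_card [pred j | pairset j \subset K]).
rewrite [in RHS]big_mkcond -[RHS]muln2 big_distrl /=.
apply: eq_bigr => j _; rewrite inE /= pairset_sub (eqP (pK j)) andbb.
by case: (_ \in K).
Qed.

(** A union of k pairs is reached from the empty set in k! orders, and no other index set is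
    reached. At k = n this gives the volume coefficient n!/n! = 1. *)
Lemma iter_lef k K : iter k lef (dx finset.set0) K =
  (paired K && (#|K| == k.*2))%:R * k`!%:R.
Proof.
elim: k K => [|k IH] K.
  rewrite dxE cards_eq0 mulr1; case: eqP => [->|]; rewrite ?andbF //.
  by rewrite (_ : paired _) //; apply/forallP => j; rewrite !inE.
rewrite iterS ffunE.
have E j : (if pairset j \subset K then iter k lef (dx finset.set0) (K :\: pairset j)
   else 0) = if pairset j \subset K then (paired K && (#|K| == k.+1.*2))%:R * k`!%:R
   else 0 :> R[i].
  case: ifPn => // jK; rewrite IH.
  have -> : paired (K :\: pairset j) = paired K.
    apply/forallP/forallP => pK i; have := pK i;
      rewrite !inE !idx_eqE ?orbF /=; case: (eqVneq i j) => [->|] //= _.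
    by move: jK; rewrite pairset_sub => /andP[-> ->].
  have -> : (#|K :\: pairset j| == k.*2) = (#|K| == k.+1.*2).
    have := cardsD K (pairset j); rewrite (finset.setIidPr jK).
    have := subset_leq_card jK.
    rewrite cards2 idx_eqE doubleS => /= ?; lia.
  by [].
under eq_bigr => j _ do rewrite E.
rewrite -big_mkcond sumr_const; case: (boolP (paired K)) => [pK|]; last first.
  by rewrite /= !mul0r mul0rn.
rewrite [#|K|]card_paired // (inj_eq double_inj) factS natrM /=.
case: eqP => [->|_]; last by rewrite !mul0r mul0rn.
by rewrite !mul1r -[LHS]mulr_natl.
Qed.

Lemma ext_vol_frame w : unimodular w ->
  ext_vol n (frame_J w) (frame_g w) [set: 'I_(n.*2)] = 1.
Proof.
move=> uw; rewrite /ext_vol extZE.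
rewrite (eq_iter (f' := lef)) => [|u]; last exact: wedge_omega.
rewrite iter_lef cardsT card_ord eqxx andbT.
have -> : paired [set: 'I_(n.*2)] by apply/forallP => j; rewrite !inE.
by rewrite mul1r mulVf // pnatr_eq0 -lt0n fact_gt0.
Qed.

(* star (dx_(~: K)) = starcoef K *: dx_K *)
Definition starcoef w K : R[i] :=
  shuffle_sign (~: K) K * (\prod_(a in ~: K) (w a) ^- 2)%:C.

Lemma ext_star_frame w u K : unimodular w ->
  ext_star n (frame_J w) (frame_g w) u K = starcoef w K * u (~: K).
Proof.
move=> uw; rewrite ffunE ext_vol_frame // mulr1 /starcoef -mulrA; congr (_ * _).
rewrite ext_innerE (bigD1 (~: K)) //= [X in _ + X]big1 => [|A AK]; last first.
  by rewrite dxE (negbTE AK) mul0r.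
rewrite addr0 dxE eqxx mul1r /ext_inner (bigD1 (~: K)) //= [X in _ + X]big1 => [|A AK]; last first.
  by apply: big1 => B _; rewrite dxE (negbTE AK) !mul0r.
rewrite addr0 (bigD1 (~: K)) //= big1 => [|A AK]; last first.
  by rewrite gram_frame // eq_sym (negbTE AK) mul0r rmorph0 mulr0.
by rewrite addr0 dxE eqxx mul1r ffunE conjCK gram_frame // eqxx mul1r mulrC.
Qed.

Lemma starcoef_neq0 w K : unimodular w -> starcoef w K != 0.
Proof.
move=> [w_gt0 _]; rewrite mulf_neq0 ?signr_eq0 //.
rewrite (rmorph_prod (real_complex R)).
apply/prodf_neq0 => a _; rewrite fmorph_eq0 invr_eq0 expf_neq0 //.
by rewrite gt_eqF.
Qed.

Lemma below_setU_pair j a K : pidx a != j -> pairset j \subset K ->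
  (-1) ^+ below a K = (-1) ^+ below a (K :\: pairset j) :> R[i].
Proof.
rewrite pairset_sub => aj /andP[xK yK].
rewrite (below_setD1 a xK) (below_setD1 (a := yidx j) a); last first.
  by rewrite !inE idx_eqE.
have -> : K :\ xidx j :\ yidx j = K :\: pairset j.
  by apply/setP => b; rewrite !inE negb_or andbCA andbA.
have -> : (yidx j < a)%N = (xidx j < a)%N.
  case: (idxP a) aj => i _ aj; rewrite !idx_ltE //.
  by rewrite [RHS]leq_eqVlt eq_sym -[(_ == _ :> nat)]/(i == j) (negbTE aj).
by rewrite addnA exprD addnn -mul2n exprM sqrrN !expr1n mul1r.
Qed.

(** Removing a whole pair preserves the shuffle sign, because pairs are even, and the product of
    weights, because w_x w_y = 1. *)
Lemma starcoef_setD_pair w j K : unimodular w -> pairset j \subset K ->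
  starcoef w (K :\: pairset j) = starcoef w K.
Proof.
move=> [w_gt0 wxy] jK; have := jK; rewrite pairset_sub => /andP[xK yK].
rewrite /starcoef !shuffle_signE; congr (_ * (_)%:C).
  rewrite ![\prod_(a in _) _]big_mkcond !big_pairs; apply: eq_bigr => i _.
  rewrite !inE !idx_eqE; case: (eqVneq i j) => [->|ij] /=.
    by rewrite xK yK /= below_y !inE eqxx addn0 -expr2 sqrr_sign mulr1.
  by rewrite -!below_setU_pair ?pidx_x ?pidx_y.
rewrite ![\prod_(a in _) _]big_mkcond !big_pairs; apply: eq_bigr => i _.
rewrite !inE !idx_eqE; case: (eqVneq i j) => [->|ij] //=.
by rewrite xK yK /= -invfM -exprMn wxy expr1n invr1 mulr1.
Qed.

Lemma lef_star w u K : unimodular w ->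
  lef (ext_star n (frame_J w) (frame_g w) u) K = starcoef w K * dlef u (~: K).
Proof.
move=> uw; rewrite !ffunE mulr_sumr; apply: eq_bigr => j _.
rewrite finset.setCK; case: ifP => jK; last by rewrite mulr0.
by rewrite ext_star_frame // starcoef_setD_pair // finset.setCD.
Qed.

Lemma ext_star_surjective w v : unimodular w ->
  exists u, ext_star n (frame_J w) (frame_g w) u = v.
Proof.
move=> uw; exists [ffun K : {set 'I_(n.*2)} => v (~: K) / starcoef w (~: K)].
apply/ffunP => K; rewrite ext_star_frame // ffunE finset.setCK.
by rewrite mulrC divfK // starcoef_neq0.
Qed.

(** [ext_starinv] also returns 0 by default; surjectivity of the star shows that here 0 is a genuine
    preimage. *)
Lemma dlef_eq0 w u : unimodular w ->
  ext_starinv n (frame_J w) (frame_g w)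
    (wedge (ext_omega (frame_J w) (frame_g w))
      (ext_star n (frame_J w) (frame_g w) u)) = 0 ->
  dlef u = 0.
Proof.
move=> uw; rewrite wedge_omega // /ext_starinv => x0.
have := @xgetPex _ 0 _ (ext_star_surjective (lef (ext_star n (frame_J w)
  (frame_g w) u)) uw).
rewrite x0 => /ffunP E; apply/ffunP => K; have := E (~: K).
rewrite lef_star // ext_star_frame // !ext0E mulr0 finset.setCK => /esym/eqP.
by rewrite mulf_eq0 (negbTE (starcoef_neq0 _ uw)) => /eqP.
Qed.

(** The relation [Lambda, L] = n - degree, written without subtraction. The terms that add a pair j
    and remove a pair i different from j agree on both sides; the diagonal ones count the pairs
    disjoint from M and the pairs inside M, and these numbers differ by n - #|M|. *)
Lemma lef_commutator u M :
  dlef (lef u) M + #|M|%:R * u M = lef (dlef u) M + n%:R * u M.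
Proof.
rewrite !ffunE.
pose F j i := if pairset j \subset ~: M then
  if pairset i \subset M then u ((M :\: pairset i) :|: pairset j) else 0 else 0 : R[i].
have E1 j : (if pairset j \subset ~: M then lef u (M :|: pairset j) else 0) =
    \sum_(i | i != j) F j i + (if pairset j \subset ~: M then u M else 0).
  rewrite /F; case: ifPn => jM; last by rewrite big1_eq addr0.
  have := jM; rewrite finset.subsetC => Mj.
  rewrite ffunE (bigD1 j) //= addrC; congr (_ + _).
    apply: eq_bigr => i ij; rewrite !pairset_sub !inE !idx_eqE (negbTE ij) !orbF.
    case: ifP => // _; congr (u _); apply: eq_set_pairs => k;
      by rewrite !inE !idx_eqE ?orbF; case: (eqVneq k i) ij => //= ->; case: eqP;
         rewrite ?orbF ?andbT.
  rewrite finset.subsetUr; congr (u _); apply/setP => a.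
  have := fintype.subsetP Mj a; rewrite !inE.
  by case: (_ || _) => //=; case: (a \in M) => //= ->.
have E2 i : (if pairset i \subset M then dlef u (M :\: pairset i) else 0) =
    \sum_(j | j != i) F j i + (if pairset i \subset M then u M else 0).
  rewrite /F; case: ifPn => iM; last first.
    by rewrite big1 ?addr0 // => j _; rewrite if_same.
  rewrite ffunE (bigD1 i) //= addrC; congr (_ + _).
    apply: eq_bigr => j ji; rewrite !pairset_sub !inE !idx_eqE.
    by rewrite (negbTE ji).
  rewrite pairset_sub !inE !idx_eqE !eqxx /=; congr (u _); apply/setP => a.
  have := fintype.subsetP iM a; rewrite !inE.
  by case: (_ || _) => //= [->|_]; rewrite ?orbF.
under eq_bigr => j _ do rewrite E1.
under [in RHS]eq_bigr => j _ do rewrite E2.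
rewrite !big_split /= (exchange_big_dep xpredT) //= -!addrA; congr (_ + _).
  by apply: eq_bigr => i _; apply: eq_bigl => j; rewrite eq_sym.
rewrite card_pairs natr_sum mulr_suml.
have -> : n%:R = \sum_(j < n) 1 :> R[i] by rewrite sumr_const card_ord.
rewrite mulr_suml -!big_split; apply: eq_bigr => j _ /=.
rewrite !pairset_sub !inE.
by case: (xidx j \in M); case: (yidx j \in M); rewrite /= ?(mul0r, mul1r) //; ring.
Qed.

End Lefschetz.

(** * Uniqueness of the pointwise Lefschetz decomposition *)

Section LefschetzUniqueness.
Context {R : realType} {n : nat}.
Implicit Types (u v : ext R n.*2) (K : {set 'I_(n.*2)}).

Lemma lefD u v : lef (u + v) = lef u + lef v.
Proof.
apply/ffunP => K; rewrite extDE !ffunE -big_split; apply: eq_bigr => j _.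
by rewrite /=; case: ifP => _; rewrite ?addr0 ?ffunE.
Qed.

Lemma lefZ c u : lef (c *: u) = c *: lef u.
Proof.
apply/ffunP => K; rewrite extZE !ffunE mulr_sumr; apply: eq_bigr => j _.
by case: ifP => _; rewrite ?mulr0 ?ffunE.
Qed.

Lemma lef0 : lef (0 : ext R n.*2) = 0.
Proof. by have := lefZ 0 0; rewrite !scale0r. Qed.

Lemma dlefD u v : dlef (u + v) = dlef u + dlef v.
Proof.
apply/ffunP => K; rewrite extDE !ffunE -big_split; apply: eq_bigr => j _.
by rewrite /=; case: ifP => _; rewrite ?addr0 ?ffunE.
Qed.

Lemma dlefZ c u : dlef (c *: u) = c *: dlef u.
Proof.
apply/ffunP => K; rewrite extZE !ffunE mulr_sumr; apply: eq_bigr => j _.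
by case: ifP => _; rewrite ?mulr0 ?ffunE.
Qed.

Lemma dlef0 : dlef (0 : ext R n.*2) = 0.
Proof. by have := dlefZ 0 0; rewrite !scale0r. Qed.

Lemma dlef_lef k u : (forall K, #|K| != k -> u K = 0) ->
  dlef (lef u) = lef (dlef u) + (n%:R - k%:R) *: u.
Proof.
move=> uk; apply/ffunP => M; have := lef_commutator u M.
rewrite extDE extZE; have [->|/uk->] := eqVneq #|M| k.
  by move=> /(canRL (addrK _)) ->; ring.
by rewrite !mulr0 !addr0.
Qed.

Lemma lef_homogeneous k u : (forall K, #|K| != k -> u K = 0) ->
  forall K, #|K| != k.+2 -> lef u K = 0.
Proof.
move=> uk K cK; rewrite ffunE big1 // => j _; case: ifP => // jK; apply: uk.
apply: contra cK => /eqP<-; rewrite (cardsD K (pairset j)) (finset.setIidPr jK).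
have := subset_leq_card jK; rewrite cards2 idx_eqE /=; lia.
Qed.

Lemma dx0_homogeneous (K : {set 'I_(n.*2)}) : #|K| != 0%N ->
  dx finset.set0 K = 0 :> R[i].
Proof. by rewrite cards_eq0 dxE => /negbTE->. Qed.

Lemma dlef_dx0 : dlef (dx finset.set0 : ext R n.*2) = 0.
Proof.
apply/ffunP => K; rewrite ext0E ffunE big1 // => j _; rewrite dxE.
case: ifP => // _; case: eqP => // /setP/(_ (xidx j)).
by rewrite !inE eqxx orbT.
Qed.

(** Applying Lambda once gives z (2n - 2) omega + (n - 2) u = 0, and once more z (2n - 2) n = 0.
    Hence z = 0, then u = 0 because n > 2, and v = 0. *)
Lemma lefschetz_unique (z : R[i]) u v : (2 < n)%N ->
  (forall K, #|K| != 2 -> u K = 0) -> dlef u = 0 -> dlef v = 0 ->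
  z *: lef (lef (dx finset.set0)) + lef u + v = 0 -> u = 0 /\ v = 0.
Proof.
move=> n2 u2 du dv E; have Eu := congr1 dlef E.
have L1 := lef_homogeneous dx0_homogeneous.
move: Eu; rewrite !dlefD dlefZ dv dlef0 addr0 (dlef_lef u2) du lef0 add0r.
rewrite (dlef_lef L1) (dlef_lef dx0_homogeneous) dlef_dx0 lef0 add0r subr0.
rewrite lefZ -scalerDl scalerA => Eu.
have := congr1 dlef Eu; rewrite dlefD !dlefZ du scaler0 addr0 dlef0.
rewrite (dlef_lef dx0_homogeneous) dlef_dx0 lef0 add0r subr0 scalerA.
move=> /ffunP/(_ finset.set0); rewrite ext0E extZE dxE eqxx mulr1 => /eqP.
have n0 : n%:R != 0 :> R[i] by rewrite pnatr_eq0; lia.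
have nn : n%:R + (n%:R - 2%:R) != 0 :> R[i].
  rewrite -natrB; last by lia.
  by rewrite -natrD pnatr_eq0; lia.
have n2' : n%:R - 2%:R != 0 :> R[i].
  by rewrite -natrB ?pnatr_eq0; lia.
rewrite !mulf_eq0 (negbTE n0) (negbTE nn) !orbF => /eqP z0.
move: Eu E; rewrite z0 mul0r !scale0r !add0r => /eqP.
rewrite scaler_eq0 (negbTE n2') /= => /eqP u0.
by rewrite u0 lef0 add0r.
Qed.

End LefschetzUniqueness.

(** * Monomials in a unitary coframe *)

Section Monomials.
Context {R : realType} {n : nat} (w : 'I_(n.*2) -> R).
Context (uw : unimodular w).
Implicit Types (j : 'I_n) (a : 'I_(n.*2)) (A K : {set 'I_(n.*2)}).
Implicit Types (s : bool * bool) (t : 'I_n -> bool * bool).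

(** The (1,0)-form w_x dx_j + i w_y dy_j for e = false and its conjugate for e = true. *)
Definition phi j (e : bool) : 'I_(n.*2) -> R[i] := fun a =>
  if a == xidx j then (w a)%:C else
  if a == yidx j then (-1) ^+ e * 'i * (w a)%:C else 0.

(* The state (p, q) of a pair selects 1, phi_j, conj phi_j or omega_j as the
   factor of bidegree (p, q); loc lists its coefficients. *)
Definition loc (wx wy : R[i]) s : bool -> bool -> R[i] := fun b b' =>
  match s with
  | (false, false) => (~~ b && ~~ b')%:R
  | (true, true) => (b && b')%:R
  | (_, e) => (b && ~~ b')%:R * wx + (~~ b && b')%:R * ((-1) ^+ e * 'i * wy)
  end.

Definition Phi t : ext R n.*2 :=
  tensor (fun j => loc (w (xidx j))%:C (w (yidx j))%:C (t j)).

Lemma lmul_zero u : lmul (fun=> 0) u = 0 :> ext R n.*2.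
Proof. by apply/ffunP => K; rewrite lmulE ext0E big1 // => a _; rewrite mulr0 mul0r. Qed.

Lemma wC_neq0 a : (w a)%:C != 0.
Proof. by case: uw => w0 _; rewrite fmorph_eq0 gt_eqF. Qed.

Lemma part_phi j e :
  part10 (frame_J w) (phi j e) = (if e then fun=> 0 else phi j e) /\
  part01 (frame_J w) (phi j e) = (if e then phi j e else fun=> 0).
Proof.
have E b : \sum_a phi j e a * (frame_J w b a)%:C =
    phi j e (flip b) * ((-1) ^+ odd b * (w b)%:C / (w (flip b))%:C).
  rewrite (eq_bigr (fun a => if a == flip b then
    phi j e (flip b) * ((-1) ^+ odd b * (w b)%:C / (w (flip b))%:C) else 0)).
    by rewrite sum_if_eq.
  move=> a _; rewrite mxE; case: eqP => [->|_]; last by rewrite rmorph0 mulr0.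
  by rewrite !rmorphM fmorphV rmorphXn rmorphN1.
have i2 : 'i * 'i = -1 :> R[i] by rewrite -expr2 sqrCi.
have swap (s x y c : R[i]) : y != 0 -> 'i * (s * 'i * y * (c * x / y)) = - (s * c * x).
  move=> y0; rewrite -[RHS]mulN1r -i2; field.
  exact: y0.
have swap' (x y c : R[i]) : x != 0 -> 'i * (x * (c * y / x)) = c * 'i * y.
  by move=> x0; field.
split; apply/funext => b; rewrite /part10 /part01 E /phi (fun_if (fun f => f b));
  case: (idxP b) => k _; rewrite ?flip_x ?flip_y !idx_eqE /=;
  case: (eqVneq k j) => [->|_]; rewrite ?swap ?swap' ?wC_neq0 //;
  case: (e); rewrite /= ?expr0 ?expr1; field;
  by [|exact: wC_neq0].
Qed.

Lemma i_sqr : 'i * 'i = -1 :> R[i].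
Proof. by rewrite -expr2 sqrCi. Qed.

Lemma local_lmul_one (wx wy : R[i]) (e : bool) :
  local_lmul wx ((-1) ^+ e * 'i * wy) one_at = loc wx wy (~~ e, e).
Proof.
apply/funext => b; apply/funext => b'; rewrite /local_lmul /loc /one_at.
by case: e b b' => -[] []; rewrite /= ?expr0 ?expr1; ring.
Qed.

Lemma local_lmul_phibar (wx wy : R[i]) : wx * wy = 1 ->
  local_lmul wx ('i * wy) (loc wx wy (false, true)) =
  fun b b' => - 2%:R * 'i * loc wx wy (true, true) b b'.
Proof.
move=> wxy; apply/funext => b; apply/funext => b'; rewrite /local_lmul /loc.
case: b b' => -[]; rewrite /= ?expr0 ?expr1; try ring.
transitivity (- 2%:R * 'i * (wx * wy)); first by ring.
by rewrite wxy; ring.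
Qed.

Lemma tensor_updateZ f j c g :
  tensor (update f j (fun b b' => c * g b b')) =
  c *: tensor (update f j g) :> ext R n.*2.
Proof.
apply/ffunP => K; rewrite extZE !tensorE !(bigD1 j (P := xpredT)) //=.
rewrite /update eqxx mulrA; congr (_ * _).
by apply: eq_bigr => i /negbTE->.
Qed.

Lemma update_update f j g g' :
  update (update f j g) j g' = update f j g' :> ('I_n -> bool -> bool -> R[i]).
Proof. by apply/funext => i; rewrite /update; case: eqP. Qed.

Lemma lmul_phi_tensor j (e : bool) f : (forall i : 'I_n, (i < j)%N -> f i = one_at) ->
  lmul (phi j e) (tensor f) =
  tensor (update f j (local_lmul (w (xidx j))%:C
    ((-1) ^+ e * 'i * (w (yidx j))%:C) (f j))).
Proof.
apply: lmul_tensor; rewrite /phi ?idx_eqE ?eqxx // => a aj.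
by case: (idxP a) aj => k _ /negbTE kj; rewrite !idx_eqE kj.
Qed.

Lemma wxyC j : (w (xidx j))%:C * (w (yidx j))%:C = 1.
Proof. by case: uw => _ wxy; rewrite -rmorphM wxy. Qed.

(** Every state arises from the empty one by left multiplications. The constant comes from omega_j =
    (i/2) phi_j /\ conj phi_j, which holds because w_x w_y = 1. *)
Lemma tensor_loc j s f : (forall i : 'I_n, (i <= j)%N -> f i = one_at) ->
  tensor (update f j (loc (w (xidx j))%:C (w (yidx j))%:C s)) =
  match s with
  | (false, false) => tensor f
  | (true, true) => (2^-1 * 'i) *: lmul (phi j false) (lmul (phi j true) (tensor f))
  | (_, e) => lmul (phi j e) (tensor f)
  end.
Proof.
move=> f1.
have f1' (i : 'I_n) : (i < j)%N -> f i = one_at by move=> /ltnW; apply: f1.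
have E e : lmul (phi j e) (tensor f) =
    tensor (update f j (loc (w (xidx j))%:C (w (yidx j))%:C (~~ e, e))).
  by rewrite lmul_phi_tensor // f1 // local_lmul_one.
case: s => -[] []; rewrite ?E //.
  rewrite lmul_phi_tensor => [|i ij]; last first.
    by rewrite /update ifF ?f1' //; apply: contraTF ij => /eqP->; rewrite ltnn.
  rewrite update_update [update _ _ _ j]/update eqxx expr0 mul1r local_lmul_phibar ?wxyC //.
  rewrite tensor_updateZ scalerA.
  have -> : 2^-1 * 'i * (- 2%:R * 'i) = 1 :> R[i].
    transitivity (- ('i * 'i) : R[i]); first by field.
    by rewrite i_sqr opprK.
  by rewrite scale1r.
congr tensor; apply/funext => i; rewrite /update; case: eqP => // ->.
by rewrite f1.
Qed.

Lemma ext_bidegree_lmul_phi p q j e u :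
  ext_bidegree (frame_J w) p q (lmul (phi j e) u) =
  if e then (if q is q'.+1 then lmul (phi j e) (ext_bidegree (frame_J w) p q' u) else 0)
  else (if p is p'.+1 then lmul (phi j e) (ext_bidegree (frame_J w) p' q u) else 0).
Proof.
rewrite ext_bidegree_lmul /graded_lmul; have [-> ->] := part_phi j e.
by case: e; rewrite ?(lmul_zero, addr0, add0r); case: p => [|p]; case: q => [|q];
  rewrite ?lmul_zero ?addr0 ?add0r.
Qed.

Lemma ext_bidegree_tensor_loc p0 q0 j s f :
  (forall i : 'I_n, (i <= j)%N -> f i = one_at) ->
  (forall p q, ext_bidegree (frame_J w) p q (tensor f) =
    ((p == p0) && (q == q0))%:R *: tensor f) ->
  forall p q, let u := tensor (update f j (loc (w (xidx j))%:C (w (yidx j))%:C s)) in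
  ext_bidegree (frame_J w) p q u =
    ((p == s.1 + p0) && (q == s.2 + q0))%N%:R *: u.
Proof.
move=> f1 fpq p q /=; rewrite tensor_loc //.
case: s => -[] [] /=; rewrite ?ext_bidegreeZ ?ext_bidegree_lmul_phi ?add0n ?add1n //.
- case: p => [|p]; first by rewrite scale0r scaler0.
  rewrite ext_bidegree_lmul_phi; case: q => [|q].
    by rewrite lmul0r andbF scale0r scaler0.
  by rewrite fpq !lmulZr !eqSS !scalerA mulrC.
- by case: p => [|p]; rewrite ?scale0r // fpq lmulZr eqSS.
- by case: q => [|q]; rewrite ?andbF ?scale0r // fpq lmulZr eqSS.
Qed.

(** Induction from the last pair to the first, since [lmul_tensor] wants the earlier pairs empty;
    [tr k] keeps the states from pair k on. *)
Lemma ext_bidegree_Phi p q t :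
  ext_bidegree (frame_J w) p q (Phi t) =
  ((p == \sum_j (t j).1) && (q == \sum_j (t j).2))%N%:R *: Phi t.
Proof.
pose tr k j := if (k <= j)%N then t j else (false, false).
pose W j s := loc (w (xidx j))%:C (w (yidx j))%:C s.
have loc0 j : W j (false, false) = one_at by [].
suff H d k : (k + d = n)%N -> forall p q, ext_bidegree (frame_J w) p q (Phi (tr k)) =
    ((p == \sum_(j < n | (k <= j)%N) (t j).1) &&
     (q == \sum_(j < n | (k <= j)%N) (t j).2))%N%:R *: Phi (tr k).
  exact: (H n 0%N).
elim: d k => [|d IH] k kd {}p {}q.
  have nk (j : 'I_n) : (k <= j)%N = false by have := ltn_ord j; lia.
  have -> : Phi (tr k) = dx finset.set0.
    rewrite -tensor_one; congr tensor; apply/funext => j.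
    by rewrite /tr nk.
  by rewrite ext_bidegree0 !big_pred0.
have kn : (k < n)%N by lia.
pose j := Ordinal kn.
have -> : Phi (tr k) = tensor (update (fun i => W i (tr k.+1 i)) j (W j (t j))).
  congr tensor; apply/funext => i; rewrite /update /W.
  case: eqP => [->|/eqP ij]; first by rewrite /tr leqnn.
  rewrite /tr leq_eqVlt (_ : (k == i) = false) //.
  by apply: contraNF ij => /eqP ki; apply/eqP/val_inj.
rewrite (@ext_bidegree_tensor_loc (\sum_(i < n | k.+1 <= i) (t i).1)%N
  (\sum_(i < n | k.+1 <= i) (t i).2)%N).
- have E (F : 'I_n -> nat) :
    (\sum_(i < n | (k <= i)%N) F i = F j + \sum_(i < n | (k.+1 <= i)%N) F i)%N.
    rewrite (bigD1 j) //=; congr (_ + _)%N; apply: eq_bigl => i.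
    by rewrite ltn_neqAle andbC eq_sym -[(_ == _ :> nat)]/(k == i).
  by rewrite !E.
- by move=> i ij; rewrite /tr ltnNge ij.
- by move=> p' q'; rewrite -/(Phi (tr k.+1)) IH // addSnnS.
Qed.

(** Modulo 2 only the pairs split by K matter: each contributes a local sign when its x lies in K,
    and any two of them contribute one more sign. *)
Lemma shuffle_sign_setC K : shuffle_sign (~: K) K = \prod_j
  ((-1) ^+ ((xidx j \in K) && (yidx j \notin K)) *
   (-1) ^+ (\sum_(i < n | (i < j)%N)
      ((xidx j \in K) (+) (yidx j \in K)) * ((xidx i \in K) (+) (yidx i \in K)))) :> R[i].
Proof.
rewrite shuffle_signE big_mkcond big_pairs; apply: eq_bigr => j _.
rewrite !inE below_y below_x.
set x := xidx j \in K; set y := yidx j \in K.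
rewrite (big_morph _ (exprD (-1 : R[i])) (expr0 _)).
rewrite [(-1) ^+ (_ + x)]exprD (big_morph _ (exprD (-1 : R[i])) (expr0 _)).
transitivity ((-1) ^+ (x && ~~ y) * \prod_(i < n | (i < j)%N)
   ((-1) ^+ ((x (+) y) * ((xidx i \in K) + (yidx i \in K)))) : R[i]).
  have E (b : bool) : \prod_(i < n | (i < j)%N)
     ((-1) ^+ (b * ((xidx i \in K) + (yidx i \in K)))) =
     (\prod_(i < n | (i < j)%N) ((-1) ^+ ((xidx i \in K) + (yidx i \in K)))) ^+ b :> R[i].
    by rewrite -prodrXl; apply: eq_bigr => i _; rewrite mulnC exprM.
  rewrite E; set P := \prod_(i < n | _) _.
  have P2 : P * P = 1.
    rewrite /P -big_split big1 // => i _; exact: (etrans (esym (expr2 _)) (sqrr_sign _ _)).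
  by case: (x); case: (y); rewrite /= ?expr0 ?expr1 ?mulr1 ?mul1r //;
    rewrite mulrC // ?P2.
congr (_ * _); rewrite (big_morph _ (exprD (-1 : R[i])) (expr0 _)).
apply: eq_bigr => i _; case: (x (+) y); case: (_ \in K); case: (_ \in K) => //.
by rewrite -[LHS]/((-1) ^+ 2) sqrrN expr1n.
Qed.

Definition dual_state s := if s.1 (+) s.2 then s else (~~ s.1, ~~ s.2).

(** The eigenvalues of the star of a complex line on phi_j and conj phi_j; on 1 and omega_j that
    star is the exchange made by [dual_state]. *)
Definition star_factor s : R[i] :=
  match s with (true, false) => - 'i | (false, true) => 'i | _ => 1 end.

Definition star_sign t : nat :=
  (\sum_(j < n) \sum_(i < n | (i < j)%N) ((t j).1 (+) (t j).2) * ((t i).1 (+) (t i).2))%N.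

Lemma loc_parity (wx wy : R[i]) s b b' : b (+) b' != s.1 (+) s.2 -> loc wx wy s b b' = 0.
Proof. by case: s b b' => -[] [] [] [] //= _; rewrite /loc /= !mul0r addr0. Qed.

Lemma loc_star (wx wy : R[i]) s (x y : bool) : wx * wy = 1 ->
  (-1) ^+ (x && ~~ y) * ((if ~~ x then wx ^- 2 else 1) * (if ~~ y then wy ^- 2 else 1)) *
    loc wx wy s (~~ x) (~~ y) =
  star_factor s * loc wx wy (dual_state s) x y.
Proof.
move=> wxy.
have wx0 : wx != 0 by apply: contra_eq_neq wxy => ->; rewrite mul0r eq_sym oner_eq0.
have -> : wy = wx^-1 by rewrite -[LHS]mul1r -(mulVf wx0) -mulrA wxy mulr1.
have i2 := i_sqr.
have iE (c : R[i]) : 'i * ('i * c) = - c by rewrite mulrA i2 mulN1r.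
by case: s x y => -[] [] [] [] /=; rewrite /loc /dual_state /= ?expr0 ?expr1
  ?(mul0r, mulr0, add0r, addr0, mul1r, mulr1, mulNr, mulrN, iE, opprK, invrK) //;
  try field.
Qed.

(** The star acts factor by factor, up to the sign of reordering the factors of odd degree. *)
Lemma ext_star_Phi t :
  ext_star n (frame_J w) (frame_g w) (Phi t) =
  ((-1) ^+ star_sign t * \prod_j star_factor (t j)) *: Phi (fun j => dual_state (t j)).
Proof.
apply/ffunP => K; rewrite ext_star_frame // extZE !tensorE /starcoef.
rewrite shuffle_sign_setC (rmorph_prod (real_complex R)).
rewrite [\prod_(a in ~: K) _]big_mkcond big_pairs -[LHS]mulrA -!big_split /=.
have [/forallP tK|] := boolP [forall j, (xidx j \in K) (+) (yidx j \in K) == (t j).1 (+) (t j).2].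
  rewrite -[RHS]mulrA -big_split /= /star_sign.
  rewrite (big_morph _ (exprD (-1 : R[i])) (expr0 _)) -big_split /=.
  apply: eq_bigr => j _; rewrite !inE -loc_star ?wxyC //.
  rewrite (eqP (tK j)).
  under eq_bigr => i _ do rewrite (eqP (tK i)).
  have E a : ((w a) ^- 2)%:C = (w a)%:C ^- 2 by rewrite fmorphV rmorphXn.
  by rewrite !E [X in X * _]mulrC -!mulrA.
(* If K splits a pair in an even state, or fails to split one in an odd state, both sides vanish. *)
rewrite negb_forall => /existsP[j jK].
rewrite (bigD1 j) //= !inE loc_parity ?addbN ?addNb ?negbK //.
rewrite !(mulr0, mul0r) [X in _ = _ * X](bigD1 j) //= loc_parity ?mul0r ?mulr0 //.
by move: jK; rewrite /dual_state; case: (t j) => -[] [].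
Qed.

End Monomials.

(** * Functions of one coordinate *)

Section TrigExpressions.
Local Open Scope classical_set_scope.
Context {R : realType}.
Implicit Types (x : R).

(* A class of functions closed under differentiation, used to prove smoothness;
   TExp s stands for exp ((-1)^s sin (2 x)). *)
Inductive texpr :=
  TCst of R | TVar | TSin | TCos | TExp of bool | TAdd of texpr & texpr | TMul of texpr & texpr.

Definition S2 x : R := sin (2 * x).
Definition C2 x : R := cos (2 * x).

Fixpoint teval (e : texpr) x : R :=
  match e with
  | TCst r => r
  | TVar => x
  | TSin => S2 x
  | TCos => C2 x
  | TExp s => expR ((-1) ^+ s * S2 x)
  | TAdd e1 e2 => teval e1 x + teval e2 x
  | TMul e1 e2 => teval e1 x * teval e2 x
  end.

Fixpoint tderiv (e : texpr) : texpr :=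
  match e with
  | TCst r => TCst 0
  | TVar => TCst 1
  | TSin => TMul (TCst 2) TCos
  | TCos => TMul (TCst (- 2)) TSin
  | TExp s => TMul (TMul (TCst ((-1) ^+ s * 2)) TCos) (TExp s)
  | TAdd e1 e2 => TAdd (tderiv e1) (tderiv e2)
  | TMul e1 e2 => TAdd (TMul (tderiv e1) e2) (TMul e1 (tderiv e2))
  end.

Lemma is_derive_double x : is_derive x 1 (fun x : R => 2 * x) 2.
Proof.
have d2 : is_derive x 1 (2 \*: (id : R -> R)) (2 *: (1 : R)) by exact: is_deriveZ.
by apply: (is_derive_eq d2); rewrite /GRing.scale /= mulr1.
Qed.

Lemma is_derive_S2 x : is_derive x 1 S2 (2 * C2 x).
Proof.
have := @is_derive1_comp R sin (fun x : R => 2 * x) x _ _ (is_derive_sin _) (is_derive_double x).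
by move=> d; apply: (is_derive_eq d); rewrite /C2 mulrC.
Qed.

Lemma is_derive_C2 x : is_derive x 1 C2 (- 2 * S2 x).
Proof.
have := @is_derive1_comp R cos (fun x : R => 2 * x) x _ _ (is_derive_cos _) (is_derive_double x).
by move=> d; apply: (is_derive_eq d); rewrite /S2; ring.
Qed.

Lemma is_derive_teval e x : is_derive x 1 (teval e) (teval (tderiv e) x).
Proof.
elim: e => [r||||s|e1 IH1 e2 IH2|e1 IH1 e2 IH2] /=.
- exact: is_derive_cst.
- exact: is_derive_id.
- exact: is_derive_S2.
- exact: is_derive_C2.
- have D : is_derive x 1 (fun x => (-1) ^+ s * S2 x) ((-1) ^+ s * (2 * C2 x)).
    exact: (@is_deriveZ _ _ _ S2 _ _ _ _ (is_derive_S2 x)).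
  have := @is_derive1_comp R expR (fun x => (-1) ^+ s * S2 x) x _ _ (is_derive_expR _) D.
  by move=> d; apply: (is_derive_eq d); ring.
- exact: is_deriveD.
- have := is_deriveM IH1 IH2.
  by move=> d; apply: (is_derive_eq d); rewrite /GRing.scale /=; ring.
Qed.

Definition regular (F : R -> R) := exists e, F = teval e.

Lemma regular_cst r : regular (fun=> r).
Proof. by exists (TCst r). Qed.

Lemma regularD F G : regular F -> regular G -> regular (fun x => F x + G x).
Proof. by move=> [e ->] [e' ->]; exists (TAdd e e'). Qed.

Lemma regularM F G : regular F -> regular G -> regular (fun x => F x * G x).
Proof. by move=> [e ->] [e' ->]; exists (TMul e e'). Qed.

Lemma regularN F : regular F -> regular (fun x => - F x).
Proof.
move=> rF; have := regularM (regular_cst (-1)) rF.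
by under [X in regular X -> _]eq_fun => x do rewrite mulN1r.
Qed.

Lemma regularX F k : regular F -> regular (fun x => F x ^+ k).
Proof.
move=> rF; elim: k => [|k IH]; first exact: regular_cst.
by under eq_fun => x do rewrite exprS; exact: regularM.
Qed.

Definition cregular (F : R -> R[i]) :=
  regular (fun x => complex.Re (F x)) /\ regular (fun x => complex.Im (F x)).

Lemma cregular_cst z : cregular (fun=> z).
Proof. by split; exact: regular_cst. Qed.

Lemma cregular_real F : regular F -> cregular (fun x => (F x)%:C).
Proof. by move=> rF; split => //=; exact: regular_cst. Qed.

Lemma ReD (z t : R[i]) : complex.Re (z + t) = complex.Re z + complex.Re t.
Proof. by case: z t => [? ?] [? ?]. Qed.

Lemma ImD (z t : R[i]) : complex.Im (z + t) = complex.Im z + complex.Im t.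
Proof. by case: z t => [? ?] [? ?]. Qed.

Lemma ReM (z t : R[i]) :
  complex.Re (z * t) = complex.Re z * complex.Re t - complex.Im z * complex.Im t.
Proof. by case: z t => [? ?] [? ?]. Qed.

Lemma ImM (z t : R[i]) :
  complex.Im (z * t) = complex.Re z * complex.Im t + complex.Im z * complex.Re t.
Proof. by case: z t => [? ?] [? ?]. Qed.

Lemma cregularD F G : cregular F -> cregular G -> cregular (fun x => F x + G x).
Proof.
move=> [rF iF] [rG iG]; split.
  by under eq_fun => x do rewrite ReD; exact: regularD.
by under eq_fun => x do rewrite ImD; exact: regularD.
Qed.

Lemma cregularM F G : cregular F -> cregular G -> cregular (fun x => F x * G x).
Proof.
move=> [rF iF] [rG iG]; split.
  by under eq_fun => x do rewrite ReM;
    apply: regularD; [exact: regularM | apply: regularN; exact: regularM].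
by under eq_fun => x do rewrite ImM; apply: regularD; exact: regularM.
Qed.

Lemma cregular_prod (I : Type) (r : seq I) (F : I -> R -> R[i]) :
  (forall i, cregular (F i)) -> cregular (fun x => \prod_(i <- r) F i x).
Proof.
move=> rF; elim: r => [|i r IH].
  by under eq_fun => x do rewrite big_nil; exact: cregular_cst.
by under eq_fun => x do rewrite big_cons; exact: cregularM.
Qed.

Lemma cregular_sum (I : Type) (r : seq I) (F : I -> R -> R[i]) :
  (forall i, cregular (F i)) -> cregular (fun x => \sum_(i <- r) F i x).
Proof.
move=> rF; elim: r => [|i r IH].
  by under eq_fun => x do rewrite big_nil; exact: cregular_cst.
by under eq_fun => x do rewrite big_cons; exact: cregularD.
Qed.

Definition cderiv (F F' : R -> R[i]) := forall x,
  is_derive x 1 (fun x => complex.Re (F x)) (complex.Re (F' x)) /\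
  is_derive x 1 (fun x => complex.Im (F x)) (complex.Im (F' x)).

Lemma eq_cderiv F F' G G' : F =1 G -> F' =1 G' -> cderiv F F' -> cderiv G G'.
Proof. by move=> /funext -> /funext ->. Qed.

Lemma cderiv_cst z : cderiv (fun=> z) (fun=> 0).
Proof. by move=> x; split; exact: is_derive_cst. Qed.

Lemma cderiv_real (F F' : R -> R) : (forall x, is_derive x 1 F (F' x)) ->
  cderiv (fun x => (F x)%:C) (fun x => (F' x)%:C).
Proof. by move=> dF x; split => //=; exact: is_derive_cst. Qed.

Lemma cderivD F F' G G' : cderiv F F' -> cderiv G G' ->
  cderiv (fun x => F x + G x) (fun x => F' x + G' x).
Proof.
move=> dF dG x; have [rF iF] := dF x; have [rG iG] := dG x.
split; rewrite ?ReD ?ImD.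
  by under eq_fun => y do rewrite ReD; exact: is_deriveD.
by under eq_fun => y do rewrite ImD; exact: is_deriveD.
Qed.

Lemma cderivM F F' G G' : cderiv F F' -> cderiv G G' ->
  cderiv (fun x => F x * G x) (fun x => F' x * G x + F x * G' x).
Proof.
move=> dF dG x; have [rF iF] := dF x; have [rG iG] := dG x.
split; rewrite ?ReD ?ImD ?ReM ?ImM.
  under eq_fun => y do rewrite ReM.
  have := is_deriveB (is_deriveM rF rG) (is_deriveM iF iG).
  by move=> d; apply: (is_derive_eq d); rewrite /GRing.scale /=; ring.
under eq_fun => y do rewrite ImM.
have := is_deriveD (is_deriveM rF iG) (is_deriveM iF rG).
by move=> d; apply: (is_derive_eq d); rewrite /GRing.scale /=; ring.
Qed.

Lemma cderiv_sum (I : Type) (r : seq I) (F F' : I -> R -> R[i]) :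
  (forall i, cderiv (F i) (F' i)) ->
  cderiv (fun x => \sum_(i <- r) F i x) (fun x => \sum_(i <- r) F' i x).
Proof.
move=> dF; elim: r => [|i r IH].
  by apply: eq_cderiv (cderiv_cst 0) => x; rewrite big_nil.
by apply: eq_cderiv (cderivD (dF i) IH) => x; rewrite big_cons.
Qed.

Lemma cderivZ c F F' : cderiv F F' -> cderiv (fun x => c * F x) (fun x => c * F' x).
Proof.
move=> dF; apply: eq_cderiv (cderivM (cderiv_cst c) dF) => x //.
by rewrite mul0r add0r.
Qed.

Lemma cderivX (F F' : R -> R[i]) k : cderiv F F' ->
  cderiv (fun x => F x ^+ k) (fun x => k%:R * F x ^+ k.-1 * F' x).
Proof.
move=> dF; elim: k => [|k IH].
  by apply: eq_cderiv (cderiv_cst 1) => x; rewrite ?expr0 ?mul0r.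
apply: eq_cderiv (cderivM dF IH) => x; first by rewrite exprS.
rewrite /= -natr1; case: k {IH} => [|k] /=; first by rewrite expr0; ring.
by rewrite exprS; ring.
Qed.

End TrigExpressions.

Section Coordinate.
Local Open Scope classical_set_scope.
Context {R : realType} {m : nat} (i0 : 'I_m).
Implicit Types (y : 'rV[R]_m) (a : 'I_m) (F : R -> R).

(** Along the basis vector a the coordinate i0 moves at speed 1 or 0; the direction [(a == i0)%:R]
    treats both cases at once. *)
Lemma growth_coordinate F y a :
  (fun h : R => h^-1 *: ((fun z : 'rV[R]_m => F (z 0 i0)) (h *: delta_mx 0 a + y) - F (y 0 i0))) =
  (fun h : R => h^-1 *: (F (h *: (a == i0)%:R + y 0 i0) - F (y 0 i0))).
Proof.
apply/funext => h; congr (_ *: (F _ - _)); rewrite !mxE eqxx /=.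
by rewrite eq_sym; congr (_ + _).
Qed.

Lemma derivable_coordinate F y a : derivable F (y 0 i0) (a == i0)%:R ->
  derivable (fun z : 'rV[R]_m => F (z 0 i0)) y (delta_mx 0 a).
Proof.
rewrite /derivable /=.
have := growth_coordinate F y a; rewrite /= => ->.
by [].
Qed.

Lemma partial_coordinate F y a :
  partial a (fun z : 'rV[R]_m => F (z 0 i0)) y = 'D_((a == i0)%:R) F (y 0 i0).
Proof.
by rewrite /partial /derive /=; have := growth_coordinate F y a; rewrite /= => ->.
Qed.

Lemma partial_regular F (F' : R -> R) a : (forall x : R, is_derive x 1 F (F' x)) ->
  partial a (fun z : 'rV[R]_m => F (z 0 i0)) =
  fun z : 'rV[R]_m => (a == i0)%:R * F' (z 0 i0).
Proof.
move=> dF; apply/funext => y; rewrite partial_coordinate.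
case: eqP => _; last by rewrite mul0r derive0.
by rewrite mul1r; have [_ ->] := dF (y 0 i0).
Qed.

Lemma smooth_coordinate F (U : set 'rV[R]_m) : regular F ->
  smooth_on U (fun z : 'rV[R]_m => F (z 0 i0)).
Proof.
move=> [e ->] s x _.
have [e' ->] : exists e', foldr partial (fun z : 'rV[R]_m => teval e (z 0 i0)) s =
    fun z : 'rV[R]_m => teval e' (z 0 i0).
  elim: s => [|a s [e' IH]] /=; first by exists e.
  rewrite IH (partial_regular _ (is_derive_teval e')).
  by exists (TMul (TCst (a == i0)%:R) (tderiv e')).
have d1 x0 : derivable (teval e') x0 1 by have [] := is_derive_teval e' x0.
split.
  apply: (@continuous_comp _ _ _ (fun z : 'rV[R]_m => z 0 i0) (teval e')).
    exact: coord_continuous.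
  by apply/differentiable_continuous/derivable1_diffP; exact: d1.
move=> a; apply: derivable_coordinate; case: eqP => _; first exact: d1.
exact: derivable0.
Qed.

End Coordinate.

(** * Tori *)

Section LocalSmooth.
Local Open Scope classical_set_scope.
Context {R : realType} {m : nat}.
Implicit Types (f g : 'rV[R]_m -> R) (U : set 'rV[R]_m) (y : 'rV[R]_m).

Lemma near_foldr_partial f g (s : seq 'I_m) (y : 'rV[R]_m) :
  (\forall z \near y, f z = g z) ->
  \forall z \near y, foldr partial f s z = foldr partial g s z.
Proof.
move=> fg; elim: s => [|a s IH] //=.
have := near_join IH; apply: filterS => z; exact: near_eq_derive.
Qed.

Lemma smooth_on_near U f : (forall y, U y -> exists2 g,
    smooth_on setT g & \forall z \near y, f z = g z) -> smooth_on U f.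
Proof.
move=> loc s x /loc[g sg fg]; have [cg dg] := sg s x I.
have nfg := near_foldr_partial s fg.
have ngf : \forall z \near x, foldr partial g s z = foldr partial f s z.
  by move: nfg; apply: filterS => z ->.
split=> [|a]; last exact: near_eq_derivable ngf (dg a).
move=> V /=; rewrite (nbhs_singleton nfg) => /cg.
by apply: filterS2 nfg => z /= ->.
Qed.

Lemma jacobian_translation (f : 'rV[R]_m -> 'rV[R]_m) (v y : 'rV[R]_m) :
  (\forall z \near y, f z = z + v) -> jacobian f y = 1%:M.
Proof.
move=> fv.
have D : 'd f y = (fun h => h) :> ('rV[R]_m -> 'rV[R]_m).
  apply: (@diff_unique _ _ _ f (idfun : {linear 'rV[R]_m -> 'rV[R]_m})).
    by move=> z; exact: cvg_id.
  apply/eqaddoP => e e0.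
  have := fv; rewrite (near_shift 0 y) /= => fv0.
  near=> h.
  have fh : f (h + y) = h + y + v.
    have : f (h + (y - 0)) = h + (y - 0) + v by near: h; exact: fv0.
    by rewrite subr0.
  rewrite /= -[X in `|X|]/(f (h + y) - (f y + h)) fh (nbhs_singleton fv).
  have -> : h + y + v - (y + v + h) = 0.
    by rewrite [y + v + h]addrC addrA subrr.
  by rewrite normr0 mulr_ge0 // ltW.
apply/matrixP => a b; rewrite /jacobian /lin1_mx !mxE D !mxE eqxx.
by rewrite eq_sym.
Unshelve. all: by end_near. Qed.

End LocalSmooth.

Section Torus.
Local Open Scope classical_set_scope.
Local Open Scope quotient_scope.
Context {R : realType} {m : nat} (T : R).
Implicit Types (y z c : 'rV[R]_m) (k : 'rV[int]_m).

Definition lattice k : 'rV[R]_m := \row_j (T * (k 0 j)%:~R).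

Lemma lattice0 : lattice 0 = 0.
Proof. by apply/rowP => j; rewrite !mxE mulr0. Qed.

Lemma latticeN k : lattice (- k) = - lattice k.
Proof. by apply/rowP => j; rewrite !mxE mulrNz mulrN. Qed.

Lemma latticeD k l : lattice (k + l) = lattice k + lattice l.
Proof. by apply/rowP => j; rewrite !mxE intrD mulrDr. Qed.

Definition torus_rel y z : bool := `[< exists k, z = y + lattice k >].

Lemma torus_rel_refl : reflexive torus_rel.
Proof. by move=> y; apply/asboolP; exists 0; rewrite lattice0 addr0. Qed.

Lemma torus_rel_sym : symmetric torus_rel.
Proof.
move=> y z; apply/asboolP/asboolP => -[k ->]; exists (- k);
by rewrite latticeN addrK.
Qed.

Lemma torus_rel_trans : transitive torus_rel.
Proof.
move=> z y u /asboolP[k ->] /asboolP[l ->]; apply/asboolP; exists (k + l).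
by rewrite latticeD addrA.
Qed.

Definition torus_equiv :=
  EquivRel torus_rel torus_rel_refl torus_rel_sym torus_rel_trans.

Definition torus : topologicalType := quotient_topology {eq_quot torus_equiv}.

Definition torus_proj y : torus := \pi_{eq_quot torus_equiv} y.

Lemma torus_projP y z :
  torus_proj y = torus_proj z <-> exists k, z = y + lattice k.
Proof. by split => [/eqmodP/asboolP|yz]; last exact/eqmodP/asboolP. Qed.

Lemma torus_proj_surj (x : torus) : exists y, torus_proj y = x.
Proof. by exists (repr x); exact: reprK. Qed.

Lemma torus_proj_continuous : continuous torus_proj.
Proof. exact: pi_continuous. Qed.

Lemma torus_proj_open (U : set 'rV[R]_m) : open U -> open (torus_proj @` U).
Proof.
move=> oU; change (open (torus_proj @^-1` (torus_proj @` U))).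
have -> : torus_proj @^-1` (torus_proj @` U) =
    \bigcup_k ((fun z => z + lattice k) @^-1` U).
  apply/seteqP; split=> [z [y Uy /esym/torus_projP[k yE]]|z [k _ /= Uk]].
    by exists k => //=; rewrite -yE.
  by exists (z + lattice k) => //; apply/esym/torus_projP; exists k.
apply: bigcup_open => k _; apply: open_comp => // z _.
by apply: continuousD; [exact: cvg_id | exact: cst_continuous].
Qed.

Lemma rV_ballP c r y : 0 < r -> ball c r y <-> forall j, `|c 0 j - y 0 j| < r.
Proof.
move=> r0; split=> [[_ yc] j|yc]; first exact: yc.
by split=> // i j; rewrite (ord1 i); exact: yc.
Qed.

Context (T_gt0 : 0 < T).

(** Points of an open sup-norm ball of radius T/2 differ by less than T in each coordinate, while a
    nonzero lattice vector has a coordinate of size at least T. *)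
Lemma torus_proj_inj c y z : ball c (T / 2) y -> ball c (T / 2) z ->
  torus_proj y = torus_proj z -> y = z.
Proof.
have T2 : 0 < T / 2 by rewrite divr_gt0.
move=> /(rV_ballP _ _ T2) yc /(rV_ballP _ _ T2) zc /torus_projP[k zE].
apply/rowP => j; move: (yc j) (zc j); rewrite zE !mxE.
have [->|kj] := eqVneq (k 0 j) 0; first by rewrite mulr0 addr0.
have k1 : 1 <= `|(k 0 j)%:~R : R|.
  by rewrite -intr_norm -[1]/(1%:~R) ler_int; move: kj; lia.
rewrite !ltr_norml => ? ?.
have : `|T * (k 0 j)%:~R| < T by rewrite ltr_norml; lra.
by rewrite normrM gtr0_norm // ltNge ler_peMr // ltW.
Qed.

(** The local inverse of [torus_proj] with values in the ball around c; outside the chart domain the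
    value c is a dummy. *)
Definition torus_chart c (x : torus) : 'rV[R]_m :=
  xget c [set y | ball c (T / 2) y /\ torus_proj y = x].

Lemma torus_chartK c y : ball c (T / 2) y -> torus_chart c (torus_proj y) = y.
Proof.
by move=> yc; apply: xget_unique => // z [zc]; exact: torus_proj_inj zc yc.
Qed.

Lemma torus_chart_im c x : (torus_proj @` ball c (T / 2)) x ->
  ball c (T / 2) (torus_chart c x).
Proof. by move=> [y yc <-]; rewrite torus_chartK. Qed.

Lemma torus_chart_map c x : (torus_proj @` ball c (T / 2)) x ->
  torus_proj (torus_chart c x) = x.
Proof. by move=> [y yc <-]; rewrite torus_chartK. Qed.

Lemma torus_cover (x : torus) : exists c, (torus_proj @` ball c (T / 2)) x.
Proof.
have [y <-] := torus_proj_surj x; exists y, y => //.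
by apply: ballxx; rewrite divr_gt0.
Qed.

Lemma torus_chart_continuous c x : (torus_proj @` ball c (T / 2)) x ->
  {for x, continuous (torus_chart c)}.
Proof.
move=> [y yc <-{x}] V; rewrite torus_chartK // => /nbhs_interior Vy.
suff : nbhs (torus_proj y) (torus_proj @` (V° `&` ball c (T / 2))).
  apply: filterS => _ [z [Vz zc] <-] /=.
  by rewrite torus_chartK //; exact: interior_subset.
apply: open_nbhs_nbhs; split.
  by apply: torus_proj_open; apply: openI; [exact: open_interior | exact: ball_open].
by exists y => //; split=> //; exact: nbhs_singleton.
Qed.

(** The lattice vector found at y serves for all nearby z because the target ball is open. *)
Lemma torus_transition c c' y : ball c (T / 2) y ->
  (torus_proj @` ball c' (T / 2)) (torus_proj y) ->
  exists k, torus_chart c' (torus_proj y) = y + lattice k /\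
    \forall z \near y, torus_chart c' (torus_proj z) = z + lattice k.
Proof.
move=> _ [u uc /esym/torus_projP[k uE]].
have E z : ball c' (T / 2) (z + lattice k) ->
    torus_chart c' (torus_proj z) = z + lattice k.
  move=> zc; rewrite -[RHS](torus_chartK zc); congr torus_chart.
  by apply/torus_projP; exists k.
exists k; split; first by apply: E; rewrite -uE.
have : \forall z \near y, ball c' (T / 2) (z + lattice k).
  have : {for y, continuous (fun z => z + lattice k)}.
    by apply: continuousD; [exact: cvg_id | exact: cst_continuous].
  apply; rewrite -uE; apply: open_nbhs_nbhs; split => //; exact: ball_open.
by apply: filterS.
Qed.

Lemma torus_smooth c c' a :
  smooth_on [set y | ball c (T / 2) y /\ (torus_proj @` ball c' (T / 2)) (torus_proj y)]
            (fun y => torus_chart c' (torus_proj y) 0 a).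
Proof.
apply: smooth_on_near => y [yc yc'].
have [k [_ nk]] := torus_transition yc yc'.
exists (fun z => z 0 a + lattice k 0 a).
  by apply: (@smooth_coordinate _ _ a (fun x => x + lattice k 0 a));
    exists (TAdd TVar (TCst (lattice k 0 a))).
by move: nk; apply: filterS => z ->; rewrite mxE.
Qed.

Lemma torus_hausdorff : hausdorff_space torus.
Proof.
rewrite open_hausdorff => x x'.
have [y <-{x}] := torus_proj_surj x; have [z <-{x'}] := torus_proj_surj x'.
move=> /eqP yz.
have [j jP] : exists j, forall l : int, z 0 j - y 0 j != T * l%:~R.
  apply: contrapT => /forallNP nj; apply: yz; apply/torus_projP.
  have /choice[k kP] j : exists l : int, z 0 j - y 0 j = T * l%:~R.
    by have /existsNP[l /negP] := nj j; rewrite negbK => /eqP; exists l.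
  by exists (\row_j k j); apply/rowP => j; rewrite !mxE -kP addrC subrK.
pose t := (z 0 j - y 0 j) / T; pose f := Num.floor t.
have tT : z 0 j - y 0 j = T * t by rewrite mulrC divfK // gt_eqF.
have /andP[ft tf] := floor_itv t.
have ft' : f%:~R < t.
  rewrite lt_neqAle ft andbT; apply: contra (jP f) => /eqP fE.
  by rewrite tT fE.
(* The distance from t to the nearest integer: balls of radius T d / 2 around y and z then stay
   disjoint modulo the lattice. *)
pose d := Num.min (t - f%:~R) ((f + 1)%:~R - t).
have d0 : 0 < d by rewrite lt_min !subr_gt0 ft' tf.
have dP (l : int) : d <= `|t - l%:~R|.
  have [lf|fl] := leP l f.
    apply: (@le_trans _ _ (t - f%:~R)); first by rewrite ge_min lexx.
    apply: le_trans (ler_norm _); rewrite lerD2l lerN2 ler_int //.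
  apply: (@le_trans _ _ ((f + 1)%:~R - t)); first by rewrite ge_min lexx orbT.
  rewrite distrC; apply: le_trans (ler_norm _); rewrite lerD2r ler_int.
  by rewrite lezD1.
pose e := T * d / 2.
have e0 : 0 < e by rewrite divr_gt0 ?mulr_gt0.
exists (torus_proj @` ball y e, torus_proj @` ball z e) => /=.
  by split; rewrite inE; [exists y|exists z] => //; exact: ballxx.
split; try exact/torus_proj_open/ball_open.
apply/eqP/seteqP; split => // _ [[y' /(rV_ballP _ _ e0) yy' <-]].
move=> [z' /(rV_ballP _ _ e0) zz' /esym/torus_projP[k z'E]].
have := dP (k 0 j); apply/negP; rewrite -ltNge.
rewrite -(ltr_pM2l T_gt0) -{1}(gtr0_norm T_gt0) -normrM mulrBr -tT.
move: (yy' j) (zz' j); rewrite z'E !mxE /e !ltr_norml; lra.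
Qed.

Lemma torus_compact : compact [set: torus].
Proof.
pose cube := [set y : 'rV[R]_m | forall j, `[0, T]%classic (y ord0 j)].
have -> : [set: torus] = torus_proj @` cube.
  apply/seteqP; split => // x _; have [y <-] := torus_proj_surj x.
  (* Subtracting T floor(y_j / T) moves each coordinate into [0, T]. *)
  pose k : 'rV[int]_m := \row_j - Num.floor (y 0 j / T).
  exists (y + lattice k); last by apply/esym/torus_projP; exists k.
  move=> j; rewrite /= in_itv /= !mxE mulrNz mulrN.
  have /andP[h1 h2] := floor_itv (y 0 j / T).
  rewrite ler_pdivlMr // in h1; rewrite ltr_pdivrMr // in h2.
  by rewrite intrD in h2; apply/andP; split; move: h1 h2; lra.
apply: continuous_compact.
  by apply: continuous_subspaceT; exact: torus_proj_continuous.
by apply: (@rV_compact _ _ (fun=> `[0, T]%classic)) => j; exact: segment_compact.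
Qed.

Lemma torus_connected : connected [set: torus].
Proof.
have -> : [set: torus] = torus_proj @` [set: 'rV[R]_m].
  apply/seteqP; split => // x _; have [y <-] := torus_proj_surj x.
  by exists y.
apply: connected_continuous_connected; last first.
  by apply: continuous_subspaceT; exact: torus_proj_continuous.
have -> : [set: 'rV[R]_m] =
    \bigcup_(y in [set: 'rV[R]_m]) ((fun t : R => t *: y) @` `[0, 1]%classic).
  apply/seteqP; split => // y _; exists y => //; exists 1; last by rewrite scale1r.
  by rewrite /= in_itv /= ler01 lexx.
apply: bigcup_connected.
  exists 0 => y _; exists 0; last by rewrite scale0r.
  by rewrite /= in_itv /= ler01 lexx.
move=> y _; apply: connected_continuous_connected; first exact: segment_connected.
by apply: continuous_subspaceT => t; apply: scalel_continuous.
Qed.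

Lemma torus_second_countable : @second_countable torus.
Proof.
pose W (rk : 'rV[rat]_m * nat) : set torus :=
  torus_proj @` ball (map_mx ratr rk.1 : 'rV[R]_m) (rk.2.+1%:R^-1).
exists (range W).
  by apply: sub_countable (countableP [set: 'rV[rat]_m * nat]); exact: card_image_le.
split=> [_ [rk _ <-]|x V].
  exact/torus_proj_open/ball_open.
have [y <-] := torus_proj_surj x => nV.
have : nbhs y (torus_proj @^-1` V) by exact: torus_proj_continuous.
move=> /nbhs_ballP[e /= e0 eV].
(* A ball of radius below e/2 whose rational centre is within that radius of y contains y and lies
   in the ball of radius e around y. *)
have [k ke] : exists n : nat, n.+1%:R^-1 < e / 2.
  exists (Num.trunc (2 / e)); rewrite -[e / 2]invrK invf_div.
  by rewrite ltf_pV2 ?posrE ?divr_gt0 // truncnS_gt.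
have k0 : 0 < k.+1%:R^-1 :> R by rewrite invr_gt0.
have [r rP] : exists r : 'rV[rat]_m, forall j, `|ratr (r 0 j) - y 0 j| < k.+1%:R^-1.
  have /choice[r rP] j : exists q : rat, `|ratr q - y 0 j| < k.+1%:R^-1.
    have : y 0 j - k.+1%:R^-1 < y 0 j + k.+1%:R^-1.
      by move: (k.+1%:R^-1 : R) k0 => d; lra.
    by move=> /rat_in_itvoo[q]; rewrite in_itv /= => qP; exists q;
      move: (k.+1%:R^-1 : R) qP => d; rewrite ltr_norml; lra.
  by exists (\row_j r j) => j; rewrite mxE.
exists (W (r, k)).
  split; first by exists (r, k).
  by exists y => //; apply/(rV_ballP _ _ k0) => j; rewrite mxE.
move=> _ [z /(rV_ballP _ _ k0) zP <-]; apply: eV; apply/(rV_ballP _ _ e0) => j.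
move: (zP j) (rP j) ke; rewrite mxE /=; move: (k.+1%:R^-1 : R) => d.
rewrite !ltr_norml; lra.
Qed.

Lemma torus_chart_inv_dom c y : ball c (T / 2) y ->
  (torus_proj @` ball c (T / 2)) (torus_proj y).
Proof. by move=> yc; exists y. Qed.

Definition torus_manifold : manifold R m.
Proof.
apply: (@Manifold R m torus 'rV[R]_m (fun c => torus_proj @` ball c (T / 2))
  (fun c => ball c (T / 2)) torus_chart (fun _ => torus_proj)).
- by move=> c; exact/torus_proj_open/ball_open.
- by move=> c; exact: ball_open.
- exact: torus_chart_im.
- exact: torus_chart_inv_dom.
- exact: torus_chart_map.
- exact: torus_chartK.
- exact: torus_chart_continuous.
- by move=> c y _; exact: torus_proj_continuous.
- exact: torus_cover.
- exact: torus_smooth.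
- exact: torus_hausdorff.
- exact: torus_second_countable.
- exact: torus_connected.
(* Transparent, since the chart domains and maps have to unfold below. *)
Defined.

Lemma torus_overlap (c c' : chart torus_manifold) y : overlap c c' y ->
  exists k, transition c c' y = y + lattice k /\
    jacobian (transition c c') y = 1%:M.
Proof.
move=> [yc yc']; have [k [ky nk]] := torus_transition yc yc'.
by exists k; split => //; exact: jacobian_translation nk.
Qed.

End Torus.

(** * Lefschetz operators on monomials *)

Section LefschetzMonomials.
Context {R : realType} {n : nat} (w : 'I_(n.*2) -> R).
Implicit Types (j : 'I_n) (K : {set 'I_(n.*2)}) (t : 'I_n -> bool * bool).

Definition set_state t j s : 'I_n -> bool * bool := fun i => if i == j then s else t i.

(** Wedging with omega_j kills phi_j, conj phi_j and omega_j, so only the empty pairs contribute. *)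
Lemma lef_Phi t : lef (Phi w t) =
  \sum_j if t j == (false, false) then Phi w (set_state t j (true, true)) else 0.
Proof.
apply/ffunP => K; rewrite ffunE sum_ffunE; apply: eq_bigr => j _.
rewrite pairset_sub [LHS](_ : _ = (t j == (false, false))%:R *
  Phi w (set_state t j (true, true)) K); last first.
  rewrite !tensorE !(bigD1 j (P := xpredT)) //= !inE !idx_eqE eqxx /=.
  rewrite {1}/set_state eqxx /= mulrCA !mulrA.
  rewrite [X in _ = _ * X](eq_bigr (fun i => loc (w (xidx i))%:C (w (yidx i))%:C
    (t i) (xidx i \in K) (yidx i \in K))); last first.
    by move=> i /negbTE ij; rewrite /set_state ij.
  rewrite [X in _ * X](eq_bigr (fun i => loc (w (xidx i))%:C (w (yidx i))%:C
    (t i) (xidx i \in K) (yidx i \in K))); last first.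
    by move=> i /negbTE ij; rewrite !inE !idx_eqE ij.
  by case: (t j) => -[] []; case: (xidx j \in K); case: (yidx j \in K);
    rewrite /= ?(mul0r, mulr0, mul1r, addr0, add0r).
by case: eqP => _; rewrite ?mul1r // mul0r ext0E.
Qed.

Lemma dlef_Phi t : dlef (Phi w t) =
  \sum_j if t j == (true, true) then Phi w (set_state t j (false, false)) else 0.
Proof.
apply/ffunP => K; rewrite ffunE sum_ffunE; apply: eq_bigr => j _.
rewrite pairset_sub !inE [LHS](_ : _ = (t j == (true, true))%:R *
  Phi w (set_state t j (false, false)) K); last first.
  rewrite !tensorE !(bigD1 j (P := xpredT)) //= !inE !idx_eqE eqxx /= !orbT.
  rewrite {1}/set_state eqxx /= mulrCA !mulrA.
  rewrite [X in _ = _ * X](eq_bigr (fun i => loc (w (xidx i))%:C (w (yidx i))%:C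
    (t i) (xidx i \in K) (yidx i \in K))); last first.
    by move=> i /negbTE ij; rewrite /set_state ij.
  rewrite [X in _ * X](eq_bigr (fun i => loc (w (xidx i))%:C (w (yidx i))%:C
    (t i) (xidx i \in K) (yidx i \in K))); last first.
    by move=> i /negbTE ij; rewrite !inE !idx_eqE ij !orbF.
  by case: (t j) => -[] []; case: (xidx j \in K); case: (yidx j \in K);
    rewrite /= ?(mul0r, mulr0, mul1r, addr0, add0r).
by case: eqP => _; rewrite ?mul1r // mul0r ext0E.
Qed.

End LefschetzMonomials.

(** * Symbolic differential forms *)

Section Symbolic.

Definition gauss : Type := (int * int)%type.
Definition gmul (z t : gauss) : gauss :=
  (z.1 * t.1 - z.2 * t.2, z.1 * t.2 + z.2 * t.1).
Definition gadd (z t : gauss) : gauss := (z.1 + t.1, z.2 + t.2).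

Definition key : Type := (nat * nat * seq (bool * bool))%type.
(* (z, (a, b, t)) stands for z cos(2 x1)^a sin(2 x1)^b times the monomial with
   states t, where z is a Gaussian integer. *)
Definition item : Type := (gauss * key)%type.
Implicit Types (z : gauss) (a b p q : nat) (t : seq (bool * bool)) (i : item) (s : seq item).

(** Positions count from 0, so phi_2 sits at position 1. Missing entries are empty pairs, and [[::]]
    stands for the constant 1. *)
Definition st t (j : nat) : bool * bool := nth (false, false) t j.
Definition parity (c : bool * bool) : bool := c.1 (+) c.2.

(* Half of the x1-derivative: the missing factor 2 is absorbed by
   2 dx1 = phi_1 + conj phi_1, which keeps all coefficients Gaussian integers. *)
Definition half_deriv i : seq item := let: (z, (a, b, t)) := i in
  (if a is a'.+1 then [:: (gmul (- a%:Z, 0) z, (a', b.+1, t))] else [::]) ++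
  (if b is b'.+1 then [:: (gmul (b%:Z, 0) z, (a.+1, b', t))] else [::]) ++
  (if parity (st t 1)
   then [:: (z, (a.+1, b, set_nth (false, false) t 1 ((st t 1).2, (st t 1).1)))]
   else [::]).

(** Multiplication by phi_1 + conj phi_1; the constants come from conj phi_1 /\ phi_1 = 2i omega_1
    and phi_1 /\ conj phi_1 = -2i omega_1. *)
Definition two_dx_lmul i : seq item := let: (z, (a, b, t)) := i in
  match st t 0 with
  | (false, false) => [:: (z, (a, b, (true, false) :: behead t));
                          (z, (a, b, (false, true) :: behead t))]
  | (true, false) => [:: (gmul (0, 2) z, (a, b, (true, true) :: behead t))]
  | (false, true) => [:: (gmul (0, -2) z, (a, b, (true, true) :: behead t))]
  | (true, true) => [::]
  end.

Definition sym_d s : seq item :=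
  flatten [seq flatten [seq two_dx_lmul i' | i' <- half_deriv i] | i <- s].

Definition pdeg t : nat := (st t 0).1 + ((st t 1).1 + ((st t 2).1 + (st t 3).1)).
Definition qdeg t : nat := (st t 0).2 + ((st t 1).2 + ((st t 2).2 + (st t 3).2)).

Definition sym_bidegree p q s : seq item :=
  [seq i <- s | (p == pdeg i.2.2) && (q == qdeg i.2.2)].

Definition sym_del s : seq item :=
  flatten [seq flatten [seq sym_bidegree p.+1 q (sym_d (sym_bidegree p q s))
    | q <- iota 0 5] | p <- iota 0 5].

Definition sym_delbar s : seq item :=
  flatten [seq flatten [seq sym_bidegree p q.+1 (sym_d (sym_bidegree p q s))
    | q <- iota 0 5] | p <- iota 0 5].

Definition dual_st (c : bool * bool) := if c.1 (+) c.2 then c else (~~ c.1, ~~ c.2).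

Definition gstar_factor (c : bool * bool) : gauss :=
  match c with (true, false) => (0, -1) | (false, true) => (0, 1) | _ => (1, 0) end.

Definition gstar_sign t : nat :=
  (parity (st t 1) * parity (st t 0) +
   (parity (st t 2) * parity (st t 0) + parity (st t 2) * parity (st t 1)) +
   (parity (st t 3) * parity (st t 0) + (parity (st t 3) * parity (st t 1) +
    parity (st t 3) * parity (st t 2))))%N.

Definition sym_star s : seq item := [seq (gmul
    (gmul (if odd (gstar_sign i.2.2) then (-1, 0) else (1, 0))
     (gmul (gstar_factor (st i.2.2 0)) (gmul (gstar_factor (st i.2.2 1))
     (gmul (gstar_factor (st i.2.2 2)) (gstar_factor (st i.2.2 3)))))) i.1,
   (i.2.1, [seq dual_st (st i.2.2 j) | j <- iota 0 4])) | i <- s].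

Definition sym_opp s : seq item := [seq (gmul (-1, 0) i.1, i.2) | i <- s].

Definition sym_del_adj s := sym_opp (sym_star (sym_delbar (sym_star s))).
Definition sym_delbar_adj s := sym_opp (sym_star (sym_del (sym_star s))).

Definition sym_laplacian (D : laplacian_kind) s : seq item :=
  match D with
  | Lap_del => sym_del (sym_del_adj s) ++ sym_del_adj (sym_del s)
  | Lap_delbar => sym_delbar (sym_delbar_adj s) ++ sym_delbar_adj (sym_delbar s)
  | Lap_BC =>
      ((((sym_del (sym_delbar (sym_delbar_adj (sym_del_adj s)))
      ++ sym_delbar_adj (sym_del_adj (sym_del (sym_delbar s))))
      ++ sym_del_adj (sym_delbar (sym_delbar_adj (sym_del s))))
      ++ sym_delbar_adj (sym_del (sym_del_adj (sym_delbar s))))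
      ++ sym_del_adj (sym_del s)) ++ sym_delbar_adj (sym_delbar s)
  | Lap_A =>
      ((((sym_del (sym_delbar (sym_delbar_adj (sym_del_adj s)))
      ++ sym_delbar_adj (sym_del_adj (sym_del (sym_delbar s))))
      ++ sym_del (sym_delbar_adj (sym_delbar (sym_del_adj s))))
      ++ sym_delbar (sym_del_adj (sym_del (sym_delbar_adj s))))
      ++ sym_del (sym_del_adj s)) ++ sym_delbar (sym_delbar_adj s)
  end.

Definition sym_lef s : seq item := flatten [seq flatten [seq
  if st i.2.2 j == (false, false)
  then [:: (i.1, (i.2.1, set_nth (false, false) i.2.2 j (true, true)))] else [::]
  | j <- iota 0 4] | i <- s].

Definition sym_dlef s : seq item := flatten [seq flatten [seq
  if st i.2.2 j == (true, true)
  then [:: (i.1, (i.2.1, set_nth (false, false) i.2.2 j (false, false)))] else [::]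
  | j <- iota 0 4] | i <- s].

Fixpoint insert_item i s : seq item :=
  if s is i' :: s' then
    if i'.2 == i.2 then (gadd i'.1 i.1, i'.2) :: s' else i' :: insert_item i s'
  else [:: i].

(** A sufficient test: like terms are collected, but the products of powers of cosine and sine are
    treated as independent. *)
Definition sym_is0 s : bool :=
  all (fun i => i.1 == (0, 0)) (foldr insert_item [::] s).

(* The coefficient at the origin of the component indexed by K, where K
   contains both coordinates of the pairs in state (true, true), the first
   coordinate of the odd ones, and nothing else. *)
Definition eval_origin (k : seq (bool * bool)) s : gauss :=
  foldr (fun i z => if (i.2.1.2 == 0%N) &&
    all (fun j => if parity (st k j) then parity (st i.2.2 j) else st i.2.2 j == st k j)
      (iota 0 4) then gadd i.1 z else z) (0, 0) s.

End Symbolic.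

(** * Soundness of the symbolic rules *)

Section Semantics.
Context {R : realType}.
Implicit Types (x : R) (z : gauss) (i : item) (s : seq item) (K : {set 'I_(4.*2)}).

Definition ord41 : 'I_4 := Ordinal (isT : 1 < 4)%N.
Definition ord40 : 'I_4 := Ordinal (isT : 0 < 4)%N.
Definition first : 'I_(4.*2) := xidx ord40.

Definition weight x : 'I_(4.*2) -> R := fun a =>
  if pidx a == ord41 then expR ((-1) ^+ odd a * S2 x) else 1.

Lemma weight_unimodular x : unimodular (weight x).
Proof.
split=> [a|j]; first by rewrite /weight; case: ifP => _; rewrite ?expR_gt0.
rewrite /weight pidx_x pidx_y; case: ifP => _; last exact: mulr1.
by rewrite -expRD /= odd_double expr0 expr1 mul1r mulN1r subrr expR0.
Qed.

Definition gval z : R[i] := z.1%:~R + 'i * z.2%:~R.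

Lemma gvalD z z' : gval (gadd z z') = gval z + gval z'.
Proof. by rewrite /gval /= !intrD; ring. Qed.

Lemma gvalM z z' : gval (gmul z z') = gval z * gval z'.
Proof.
rewrite /gval /gmul /= !intrD !intrN !intrM.
have i2 := @i_sqr R.
transitivity (z.1%:~R * z'.1%:~R + ('i * 'i) * (z.2%:~R * z'.2%:~R)
  + 'i * (z.1%:~R * z'.2%:~R + z.2%:~R * z'.1%:~R) : R[i]); last by ring.
by rewrite i2; ring.
Qed.

Lemma gval_int (k : int) : gval (k, 0) = k%:~R.
Proof. by rewrite /gval /= mulr0 addr0. Qed.

Definition monomial x t : ext R 4.*2 := Phi (weight x) (fun j => st t j).

Definition feval_item x i : ext R 4.*2 :=
  let: (z, (a, b, t)) := i in
  (gval z * (C2 x ^+ a * S2 x ^+ b)%:C) *: monomial x t.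

Definition feval s x : ext R 4.*2 := \sum_(i <- s) feval_item x i.

Lemma feval_nil x : feval [::] x = 0.
Proof. exact: big_nil. Qed.

Lemma feval_cat s s' x : feval (s ++ s') x = feval s x + feval s' x.
Proof. exact: big_cat. Qed.

Lemma feval1 i x : feval [:: i] x = feval_item x i.
Proof. exact: big_seq1. Qed.

Lemma feval_cons i s x : feval (i :: s) x = feval_item x i + feval s x.
Proof. exact: big_cons. Qed.

Lemma feval_flatten (I : Type) (r : seq I) (F : I -> seq item) x :
  feval (flatten [seq F k | k <- r]) x = \sum_(k <- r) feval (F k) x.
Proof. by rewrite /feval big_flatten big_map. Qed.

Lemma feval_item_gmul z i x : feval_item x (gmul z i.1, i.2) = gval z *: feval_item x i.
Proof. by case: i => c [[a b] t] /=; rewrite gvalM scalerA mulrA. Qed.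

Lemma feval_opp s x : feval (sym_opp s) x = - feval s x.
Proof.
rewrite /feval big_map -sumrN; apply: eq_bigr => i _.
by rewrite feval_item_gmul gval_int scaleN1r.
Qed.

Lemma feval_bidegree p q s x :
  ext_bidegree (frame_J (weight x)) p q (feval s x) = feval (sym_bidegree p q s) x.
Proof.
have E : feval s x = \sum_(i <- s) 1 *: feval_item x i.
  by apply: eq_bigr => i _; rewrite scale1r.
rewrite E ext_bidegree_sum /feval big_filter [RHS]big_mkcond.
apply: eq_bigr => -[z [[a b] t]] _; rewrite scale1r ext_bidegreeZ.
rewrite ext_bidegree_Phi; last exact: weight_unimodular.
rewrite !big_ord_recl !big_ord0 /= !addn0 /pdeg /qdeg.
by case: ifP => _; rewrite ?scale1r // scale0r scaler0.
Qed.

Lemma ext_star_sum (I : Type) (r : seq I) (F : I -> ext R 4.*2) x :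
  ext_star 4 (frame_J (weight x)) (frame_g (weight x)) (\sum_(k <- r) F k) =
  \sum_(k <- r) ext_star 4 (frame_J (weight x)) (frame_g (weight x)) (F k).
Proof.
have uw := weight_unimodular x.
apply/ffunP => K; rewrite ext_star_frame // !sum_ffunE mulr_sumr.
by apply: eq_bigr => k _; rewrite ext_star_frame.
Qed.

Lemma ext_starZ c u x :
  ext_star 4 (frame_J (weight x)) (frame_g (weight x)) (c *: u) =
  c *: ext_star 4 (frame_J (weight x)) (frame_g (weight x)) u.
Proof.
have uw := weight_unimodular x.
by apply/ffunP => K; rewrite extZE !ext_star_frame // extZE mulrCA.
Qed.

Lemma sum_pairs4 (p : nat -> nat) :
  (\sum_(j < 4) \sum_(i < 4 | i < j) p j * p i =
   p 1 * p 0 + (p 2 * p 0 + p 2 * p 1) + (p 3 * p 0 + (p 3 * p 1 + p 3 * p 2)))%N.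
Proof.
under eq_bigr => j _ do rewrite big_mkcond.
by rewrite !big_ord_recl !big_ord0 /= !addn0 !add0n addnA.
Qed.

Lemma star_signE t : star_sign (fun j : 'I_4 => st t j) = gstar_sign t.
Proof. exact: sum_pairs4 (fun j => parity (st t j)). Qed.

Lemma gstar_factorE c : gval (gstar_factor c) = star_factor c.
Proof.
by case: c => -[] []; rewrite /gval /= ?mulr0 ?mulr1 ?addr0 ?add0r ?mulrN1.
Qed.

Lemma feval_star s x :
  ext_star 4 (frame_J (weight x)) (frame_g (weight x)) (feval s x) =
  feval (sym_star s) x.
Proof.
rewrite /feval ext_star_sum big_map; apply: eq_bigr => i _.
rewrite (feval_item_gmul _ (i.1, (i.2.1, [seq dual_st (st i.2.2 j) | j <- iota 0 4]))).
case: i => z [[a b] t]; rewrite [feval_item _ _]/= [feval_item x _]/=.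
rewrite ext_starZ ext_star_Phi; last exact: weight_unimodular.
rewrite !scalerA; congr (_ *: _); last first.
  congr Phi; apply/funext => -[[|[|[|[|//]]]] j4] //=.
rewrite star_signE mulrC !big_ord_recl big_ord0 !gvalM !gstar_factorE mulr1 /=.
congr (_ * _ * _); rewrite -signr_odd; case: (odd _);
  by rewrite gval_int ?expr0 ?expr1.
Qed.

Lemma loc_lmul_dx (s : bool * bool) :
  (fun b b' => 2 * local_lmul 1 0 (loc 1 1 s) b b') =
  match s with
  | (false, false) => fun b b' => loc 1 1 (true, false) b b' + loc 1 1 (false, true) b b'
  | (true, false) => fun b b' => 2 * 'i * loc 1 1 (true, true) b b'
  | (false, true) => fun b b' => - 2 * 'i * loc 1 1 (true, true) b b'
  | (true, true) => fun=> fun=> 0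
  end :> (bool -> bool -> R[i]).
Proof.
apply/funext => b; apply/funext => b'; case: s b b' => -[] [] [] [];
  by rewrite /local_lmul /loc /= ?expr0 ?expr1; ring.
Qed.

Lemma weight_first x : weight x (xidx ord40) = 1 /\ weight x (yidx ord40) = 1.
Proof. by rewrite /weight pidx_x pidx_y. Qed.

Lemma tensorZ (f : 'I_4 -> bool -> bool -> R[i]) j (c : R[i]) :
  c *: tensor f = tensor (update f j (fun b b' => c * f j b b')).
Proof.
rewrite tensor_updateZ; congr (_ *: _); congr tensor; apply/funext => k.
by rewrite /update; case: eqP => [->|].
Qed.

Lemma tensor_updateD (f : 'I_4 -> bool -> bool -> R[i]) j g g' :
  tensor (update f j (fun b b' => g b b' + g' b b')) =
  tensor (update f j g) + tensor (update f j g').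
Proof.
apply/ffunP => K; rewrite extDE !tensorE !(bigD1 j (P := xpredT)) //=.
rewrite /update eqxx mulrDl; congr (_ * _ + _ * _);
  by apply: eq_bigr => i /negbTE->.
Qed.

Lemma lmul_first x t :
  lmul (delta first) (monomial x t) =
  tensor (update (fun j : 'I_4 => loc (weight x (xidx j))%:C (weight x (yidx j))%:C (st t j))
    ord40 (local_lmul 1 0 (loc 1 1 (st t 0)))).
Proof.
have [w1 w2] := weight_first x.
rewrite (@lmul_tensor _ _ ord40 1 0).
- by rewrite w1 w2 rmorph1.
- by rewrite /delta eqxx.
- by rewrite /delta yx_eq.
- move=> a; rewrite /delta; case: (eqVneq a first) => // ->.
  by rewrite pidx_x eqxx.
- by [].
Qed.

Lemma update_monomial x t c :
  tensor (update (fun j : 'I_4 => loc (weight x (xidx j))%:C (weight x (yidx j))%:C (st t j))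
    ord40 (loc 1 1 c)) = monomial x (c :: behead t).
Proof.
have [w1 w2] := weight_first x.
congr tensor; apply/funext => j; rewrite /update.
case: eqP => [->|/eqP j0]; first by rewrite w1 w2 rmorph1.
by case: j j0 => -[//|j] j4 _; rewrite /st /= nth_behead.
Qed.

Lemma feval_two_dx_lmul i x :
  2 *: lmul (delta first) (feval_item x i) = feval (two_dx_lmul i) x.
Proof.
case: i => z [[a b] t]; rewrite [feval_item _ _]/=.
rewrite lmulZr scalerA mulrC -scalerA.
have -> : 2 *: lmul (delta first) (monomial x t) = match st t 0 with
  | (false, false) =>
      monomial x ((true, false) :: behead t) + monomial x ((false, true) :: behead t)
  | (true, false) => (2 * 'i) *: monomial x ((true, true) :: behead t)
  | (false, true) => (- 2 * 'i) *: monomial x ((true, true) :: behead t)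
  | (true, true) => 0
  end.
  rewrite lmul_first (tensorZ _ ord40) update_update [update _ _ _ ord40]/update eqxx.
  rewrite loc_lmul_dx; case: (st t 0) => -[] [].
  - apply/ffunP => K; rewrite tensorE ext0E (bigD1 ord40) //= /update eqxx.
    by rewrite mul0r.
  - by rewrite tensor_updateZ update_monomial.
  - by rewrite tensor_updateZ update_monomial.
  - by rewrite tensor_updateD !update_monomial.
rewrite /two_dx_lmul; case: (st t 0) => -[] [].
- by rewrite feval_nil scaler0.
- rewrite feval1 (feval_item_gmul (0, 2) (z, (a, b, (true, true) :: behead t))) /=.
  rewrite !scalerA; congr (_ *: _); rewrite {2}/gval /= add0r; ring.
- rewrite feval1 (feval_item_gmul (0, -2) (z, (a, b, (true, true) :: behead t))) /=.
  rewrite !scalerA; congr (_ *: _); rewrite {2}/gval /= add0r intrN; ring.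
by rewrite !feval_cons feval_nil addr0 /= scalerDr.
Qed.

Lemma is_derive_weight a x : is_derive x (1 : R) (fun x => weight x a)
  (2 * C2 x * (if pidx a == ord41 then (-1) ^+ odd a * weight x a else 0)).
Proof.
rewrite /weight; case: (pidx a == _); last by rewrite mulr0; exact: is_derive_cst.
have := is_derive_teval (TExp (odd a)) x.
by move=> d; apply: (is_derive_eq d); rewrite /=; ring.
Qed.

(** On the second pair w_x' = u' w_x and w_y' = - u' w_y, with u' = 2 cos(2 x), so phi_2
    differentiates to u' times its conjugate: the entries of the state are swapped. All other
    factors are constant. *)
Lemma cderiv_loc j c b b' :
  cderiv (fun x => loc (weight x (xidx j))%:C (weight x (yidx j))%:C c b b')
    (fun x => (2 * C2 x)%:C * (if (j == ord41) && parity c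
      then loc (weight x (xidx j))%:C (weight x (yidx j))%:C (c.2, c.1) b b' else 0)).
Proof.
have dx := cderiv_real (is_derive_weight (xidx j)).
have dy := cderiv_real (is_derive_weight (yidx j)).
have cst (z : R[i]) : cderiv (fun=> z) (fun x => (2 * C2 x)%:C * 0).
  by apply: eq_cderiv (cderiv_cst z) => x; rewrite ?mulr0.
case: c => -[] [] /=; rewrite ?andbT ?andbF; try exact: cst.
  apply: eq_cderiv (cderivD (cderivZ (b && ~~ b')%:R dx)
    (cderivZ ((~~ b && b')%:R * ((-1) ^+ false * 'i)) dy)) => x.
    by rewrite /loc !mulrA.
  rewrite pidx_x pidx_y /= !odd_double /loc; case: ifP => _.
    by rewrite !rmorphM /= rmorphXn rmorphN1 !expr0 !expr1; ring.
  by rewrite !mulr0 addr0.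
apply: eq_cderiv (cderivD (cderivZ (b && ~~ b')%:R dx)
  (cderivZ ((~~ b && b')%:R * ((-1) ^+ true * 'i)) dy)) => x.
  by rewrite /loc !mulrA.
rewrite pidx_x pidx_y /= !odd_double /loc; case: ifP => _.
  by rewrite !rmorphM /= rmorphXn rmorphN1 !expr0 !expr1; ring.
by rewrite !mulr0 addr0.
Qed.

Definition swap_st t := set_nth (false, false) t 1 ((st t 1).2, (st t 1).1).

Lemma cderiv_monomial t K : cderiv (fun x => monomial x t K)
  (fun x => (2 * C2 x)%:C * (if parity (st t 1) then monomial x (swap_st t) K else 0)).
Proof.
pose P := \prod_(j < 4 | j != ord41) loc 1 1 (st t j) (xidx j \in K) (yidx j \in K) : R[i].
have PE x t' : (forall j : 'I_4, j != ord41 -> st t' j = st t j) -> monomial x t' K =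
    loc (weight x (xidx ord41))%:C (weight x (yidx ord41))%:C (st t' 1)
      (xidx ord41 \in K) (yidx ord41 \in K) * P.
  move=> tt'; rewrite /monomial tensorE (bigD1 ord41) //=; congr (_ * _).
  apply: eq_bigr => j j1; rewrite /weight pidx_x pidx_y (negbTE j1) rmorph1.
  by rewrite tt'.
apply: eq_cderiv (cderivM (cderiv_loc ord41 (st t 1) (xidx ord41 \in K) (yidx ord41 \in K))
  (cderiv_cst P)) => x.
  by rewrite PE.
rewrite mulr0 addr0 eqxx /=; case: ifP => _; last by rewrite !mulr0 mul0r.
rewrite PE /swap_st ?/st ?nth_set_nth /= ?mulrA // => j j1.
rewrite nth_set_nth /=; case: eqP => // jE.
by case/eqP: j1; apply: val_inj.
Qed.

(** The product rule: the three lists of [half_deriv] come from the cosine, the sine and the factor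
    on the second pair. *)
Lemma cderiv_eval_item i K : cderiv (fun x => feval_item x i K)
  (fun x => 2 * feval (half_deriv i) x K).
Proof.
case: i => z [[a b] t].
have dC := cderivX a (cderiv_real (@is_derive_C2 R)).
have dS := cderivX b (cderiv_real (@is_derive_S2 R)).
have := cderivM (cderivZ (gval z) (cderivM dC dS)) (cderiv_monomial t K).
apply: eq_cderiv => x.
  by rewrite [feval_item _ _]/= extZE !rmorphM /= !rmorphXn.
rewrite /half_deriv !feval_cat !extDE -/(swap_st t).
have -> : feval (if a is a'.+1 then [:: (gmul (- a%:Z, 0) z, (a', b.+1, t))] else [::]) x K =
  - a%:R * gval z * (C2 x ^+ a.-1 * S2 x ^+ b.+1)%:C * monomial x t K.
  case: a {dC} => [|a]; first by rewrite feval_nil ext0E mulr0n oppr0 !mul0r.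
  by rewrite feval1 /= extZE gvalM gval_int intrN.
have -> : feval (if b is b'.+1 then [:: (gmul (b%:Z, 0) z, (a.+1, b', t))] else [::]) x K =
  b%:R * gval z * (C2 x ^+ a.+1 * S2 x ^+ b.-1)%:C * monomial x t K.
  case: b {dS} => [|b]; first by rewrite feval_nil ext0E mulr0n !mul0r.
  by rewrite feval1 /= extZE gvalM gval_int.
have -> : feval (if parity (st t 1) then [:: (z, (a.+1, b, swap_st t))] else [::]) x K =
  gval z * (C2 x ^+ a.+1 * S2 x ^+ b)%:C *
    (if parity (st t 1) then monomial x (swap_st t) K else 0).
  by case: ifP => _; rewrite ?feval1 ?extZE // feval_nil ext0E mulr0.
rewrite !exprS !rmorphM /= !rmorphXn rmorphN /= rmorph_nat.
by case: (parity _); ring.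
Qed.

Lemma cderiv_eval s K : cderiv (fun x => feval s x K)
  (fun x => 2 * feval (flatten [seq half_deriv i | i <- s]) x K).
Proof.
apply: eq_cderiv (cderiv_sum s (fun i => cderiv_eval_item i K)) => x.
  by rewrite sum_ffunE.
by rewrite feval_flatten sum_ffunE mulr_sumr.
Qed.

(** On forms depending on x1 alone, d is dx1 /\ d/dx1; the factor 2 of the derivative is moved to
    dx1. *)
Lemma feval_d s x :
  2 *: lmul (delta first) (feval (flatten [seq half_deriv i | i <- s]) x) =
  feval (sym_d s) x.
Proof.
rewrite !feval_flatten lmul_sumr scaler_sumr; apply: eq_bigr => i _.
rewrite feval_flatten {1}/feval lmul_sumr scaler_sumr.
by apply: eq_bigr => i' _; exact: feval_two_dx_lmul.
Qed.

Lemma feval_insert i s x : feval (insert_item i s) x = feval_item x i + feval s x.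
Proof.
elim: s => [|i' s IH] /=; first by rewrite feval1 feval_nil addr0.
rewrite feval_cons; case: eqP => [ii'|_].
  rewrite feval_cons addrA; congr (_ + _).
  case: i i' ii' {IH} => z k [z' k'] /= ->; case: k => [[a b] t].
  by rewrite -scalerDl -mulrDl gvalD addrC.
by rewrite feval_cons IH addrCA.
Qed.

Lemma feval_is0 s x : sym_is0 s -> feval s x = 0.
Proof.
have -> : feval s x = feval (foldr insert_item [::] s) x.
  elim: s => //= i s IH; by rewrite feval_insert -IH feval_cons.
move=> /allP s0; rewrite /feval big_seq big1 // => -[z [[a b] t]] /s0 /eqP /= ->.
by rewrite gval_int mul0r scale0r.
Qed.

Lemma feval_lef s x : lef (feval s x) = feval (sym_lef s) x.
Proof.
rewrite feval_flatten /feval.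
have -> : lef (\sum_(i <- s) feval_item x i) = \sum_(i <- s) lef (feval_item x i).
  by elim/big_rec2: _ => [|i u v _ <-]; rewrite ?lef0 // lefD.
apply: eq_bigr => -[z [[a b] t]] _; rewrite -/(feval _ x) feval_flatten.
rewrite [feval_item _ _]/= lefZ lef_Phi scaler_sumr.
rewrite -[iota 0 4]/(index_iota 0 4) big_mkord; apply: eq_bigr => j _.
case: ifP => _; last by rewrite scaler0 feval_nil.
rewrite feval1 /=; congr (_ *: _); congr Phi; apply/funext => k.
by rewrite /set_state /st nth_set_nth.
Qed.

Lemma feval_dlef s x : dlef (feval s x) = feval (sym_dlef s) x.
Proof.
rewrite feval_flatten /feval.
have -> : dlef (\sum_(i <- s) feval_item x i) = \sum_(i <- s) dlef (feval_item x i).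
  by elim/big_rec2: _ => [|i u v _ <-]; rewrite ?dlef0 // dlefD.
apply: eq_bigr => -[z [[a b] t]] _; rewrite -/(feval _ x) feval_flatten.
rewrite [feval_item _ _]/= dlefZ dlef_Phi scaler_sumr.
rewrite -[iota 0 4]/(index_iota 0 4) big_mkord; apply: eq_bigr => j _.
case: ifP => _; last by rewrite scaler0 feval_nil.
rewrite feval1 /=; congr (_ *: _); congr Phi; apply/funext => k.
by rewrite /set_state /st nth_set_nth.
Qed.

Definition state_set (k : seq (bool * bool)) : {set 'I_(4.*2)} :=
  [set a | if parity (st k (pidx a)) then ~~ odd a else (st k (pidx a)).1].

Lemma prod_bool4 (q : nat -> bool) :
  \prod_(j < 4) (q j)%:R = (all q (iota 0 4))%:R :> R[i].
Proof.
rewrite !big_ord_recl big_ord0 /=.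
by do 4 case: (q _); rewrite /= ?(mul0r, mulr0, mulr1).
Qed.

(** At the origin the cosine is 1, the sine 0 and every weight 1. Both phi_j and conj phi_j have
    coefficient 1 at dx_j, so an item contributes its Gaussian coefficient or 0. *)
Lemma eval_originP k s : gval (eval_origin k s) = feval s 0 (state_set k).
Proof.
elim: s => [|[z [[a b] t]] s IH]; first by rewrite feval_nil ext0E gval_int.
rewrite feval_cons extDE -IH [feval_item _ _]/= extZE [eval_origin _ (_ :: _)]/eval_origin.
rewrite [foldr _ _ _]/= -/(eval_origin k s).
have -> : C2 0 = 1 :> R by rewrite /C2 mulr0 cos0.
have -> : S2 0 = 0 :> R by rewrite /S2 mulr0 sin0.
rewrite expr1n mul1r expr0n /monomial tensorE.
rewrite (eq_bigr (fun j : 'I_4 => (if parity (st k j) then parity (st t j)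
  else st t j == st k j)%:R)); last first.
  move=> j _; rewrite /weight !inE pidx_x pidx_y /= !odd_double /S2 mulr0 sin0 mulr0 expR0 !if_same.
  by case: (st k j) => -[] []; case: (st t j) => -[] []; rewrite /loc /=
    ?(mulr0, mul0r, mulr1, addr0, add0r).
rewrite (prod_bool4 (fun j => if parity (st k j) then parity (st t j)
  else st t j == st k j)) rmorph_nat.
case: (b == 0%N) => /=; last by rewrite mulr0 mul0r add0r.
by case: ifP => _; rewrite ?gvalD ?mulr1 // mulr0 add0r.
Qed.

End Semantics.

(** * The almost Kahler torus *)

Section AlmostKahlerTorus.
Local Open Scope classical_set_scope.
Context {R : realType}.
Implicit Types (x : R) (s : seq item).
Local Notation V := 'rV[R]_(4.*2).

Lemma S2_periodic x (k : int) : S2 (x + pi * k%:~R) = S2 x.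
Proof.
have nat_per (z : R) (n : nat) : S2 (z + pi * n%:R) = S2 z.
  by rewrite /S2 -[RHS](periodicn (@sinD2pi R) n) mulrDr -mulrnA mulrCA -natrM mulr_natr.
case: k => n; first exact: nat_per.
by rewrite NegzE mulrNz mulrN -[LHS](nat_per _ n.+1) subrK.
Qed.

Lemma C2_periodic x (k : int) : C2 (x + pi * k%:~R) = C2 x.
Proof.
have nat_per (z : R) (n : nat) : C2 (z + pi * n%:R) = C2 z.
  by rewrite /C2 -[RHS](periodicn (@cosD2pi R) n) mulrDr -mulrnA mulrCA -natrM mulr_natr.
case: k => n; first exact: nat_per.
by rewrite NegzE mulrNz mulrN -[LHS](nat_per _ n.+1) subrK.
Qed.

Lemma weight_periodic x (k : int) : weight (x + pi * k%:~R) = weight x.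
Proof. by apply/funext => a; rewrite /weight S2_periodic. Qed.

Lemma feval_periodic s x (k : int) : feval s (x + pi * k%:~R) = feval s x.
Proof.
rewrite /feval; apply: eq_bigr => -[z [[a b] t]] _.
by rewrite /= S2_periodic C2_periodic /monomial weight_periodic.
Qed.

Lemma regular_weight a : regular (fun x => weight x a).
Proof.
rewrite /weight; case: (_ == _); first by exists (TExp (odd a)).
exact: regular_cst.
Qed.

Lemma regular_weightV a : regular (fun x => (weight x a)^-1).
Proof.
rewrite /weight; case: (_ == _); last by rewrite invr1; exact: regular_cst.
exists (TExp (~~ odd a)); apply/funext => x; rewrite -expRN /=; congr expR.
by case: (odd a); rewrite /= ?expr0 ?expr1; ring.
Qed.

Lemma regular_frame_J a b : regular (fun x => frame_J (weight x) a b).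
Proof.
have [ab|ab] := boolP (b == flip a); last first.
  rewrite (_ : (fun x => _) = fun=> 0); first exact: regular_cst.
  by apply/funext => x; rewrite mxE (negbTE ab).
rewrite (_ : (fun x => _) = fun x => (-1) ^+ odd a * weight x a * (weight x b)^-1).
  apply: regularM; last exact: regular_weightV.
  by apply: regularM; [exact: regular_cst | exact: regular_weight].
by apply/funext => x; rewrite mxE ab.
Qed.

Lemma regular_frame_g a b : regular (fun x => frame_g (weight x) a b).
Proof.
rewrite (_ : (fun x => _) = fun x => (a == b)%:R * (weight x a * weight x a)).
  apply: regularM; first exact: regular_cst.
  by apply: regularM; exact: regular_weight.
by apply/funext => x; rewrite !mxE mulr_natl expr2.
Qed.

Definition ktorus_base : manifold R 4.*2 := torus_manifold (pi_gt0 R).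

Lemma ktorus_transition (c c' : chart ktorus_base) (y : V) : overlap c c' y ->
  jacobian (transition c c') y = 1%:M /\
  exists k : int, transition c c' y 0 first = y 0 first + pi * k%:~R.
Proof.
move=> /torus_overlap[k [-> ->]]; split => //.
by exists (k 0 first); rewrite !mxE.
Qed.

Lemma ktorus_J_smooth (c : chart ktorus_base) a b :
  smooth_on (chart_im c) (fun y : V => frame_J (weight (y 0 first)) a b).
Proof.
apply: (@smooth_coordinate _ _ first (fun x => frame_J (weight x) a b)).
exact: regular_frame_J.
Qed.

Lemma ktorus_g_smooth (c : chart ktorus_base) a b :
  smooth_on (chart_im c) (fun y : V => frame_g (weight (y 0 first)) a b).
Proof.
apply: (@smooth_coordinate _ _ first (fun x => frame_g (weight x) a b)).
exact: regular_frame_g.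
Qed.

Lemma ktorus_J_tensor (c c' : chart ktorus_base) (y : V) : overlap c c' y ->
  let T := jacobian (transition c c') y in
  frame_J (weight (y 0 first)) *m T =
  T *m frame_J (weight (transition c c' y 0 first)).
Proof.
by move=> /ktorus_transition[-> [k ->]] /=; rewrite weight_periodic mulmx1 mul1mx.
Qed.

Lemma ktorus_g_tensor (c c' : chart ktorus_base) (y : V) : overlap c c' y ->
  let T := jacobian (transition c c') y in
  frame_g (weight (y 0 first)) =
  T *m frame_g (weight (transition c c' y 0 first)) *m T^T.
Proof.
move=> /ktorus_transition[-> [k ->]] /=.
by rewrite weight_periodic trmx1 mulmx1 mul1mx.
Qed.

Definition ktorus : almost_Hermitian R 4 :=
  @AlmostHermitian R 4 ktorus_base
    (fun _ y => frame_J (weight (y 0 first)))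
    (fun _ y => frame_g (weight (y 0 first)))
    ktorus_J_smooth ktorus_g_smooth ktorus_J_tensor ktorus_g_tensor
    (fun _ y _ => frame_J_sqr (weight_unimodular (y 0 first)))
    (fun _ y _ => frame_g_sym (weight (y 0 first)))
    (fun _ y _ => frame_g_pos (weight_unimodular (y 0 first)))
    (fun _ y _ => frame_g_J (weight_unimodular (y 0 first))).

Local Notation dform := (chart ktorus -> V -> ext R 4.*2).

(** One expression serves in all charts, because transitions move x1 by multiples of pi, a period of
    all coefficients. *)
Definition sform s : dform := fun _ y => feval s (y 0 first).

Lemma cregular_eval s K : cregular (fun x => feval s x K).
Proof.
rewrite (_ : (fun x => _) = fun x => \sum_(i <- s) feval_item x i K); last first.
  by apply/funext => x; rewrite sum_ffunE.
apply: cregular_sum => -[z [[a b] t]].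
rewrite (_ : (fun x => _) = fun x => gval z * (C2 x ^+ a * S2 x ^+ b)%:C *
  \prod_j loc (weight x (xidx j))%:C (weight x (yidx j))%:C (st t j)
    (xidx j \in K) (yidx j \in K)); last first.
  by apply/funext => x; rewrite /= extZE tensorE.
apply: cregularM.
  apply: cregularM; first exact: cregular_cst.
  apply: cregular_real; apply: regularM; apply: regularX.
    by exists TCos.
  by exists TSin.
apply: cregular_prod => j.
have cw e : cregular (fun x => (weight x e)%:C) by exact/cregular_real/regular_weight.
case: (st t j) => -[] []; try exact: cregular_cst.
  apply: cregularD; apply: cregularM => //; try exact: cregular_cst.
  by apply: cregularM => //; exact: cregular_cst.
apply: cregularD; apply: cregularM => //; try exact: cregular_cst.
by apply: cregularM => //; exact: cregular_cst.
Qed.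

Lemma sform_is_form s : is_form (sform s).
Proof.
split=> [c A|c c' y].
  have [rR iR] := cregular_eval s A.
  split.
    exact: (@smooth_coordinate _ _ first (fun x => complex.Re (feval s x A))).
  exact: (@smooth_coordinate _ _ first (fun x => complex.Im (feval s x A))).
move=> /(@ktorus_transition c c' y)[jk [k tk]].
by rewrite /sform [in RHS]tk feval_periodic [X in pullback X]jk pullback1.
Qed.

(** Only the partial derivative along [first] survives, which leaves the formula [lmulE] for dx1.
    The equality also holds off the chart images, so operators can be rewritten inside one
    another. *)
Lemma sform_d s : exterior_d (sform s) = sform (sym_d s).
Proof.
apply/funext => c; apply/funext => y; rewrite /sform -feval_d.
apply/ffunP => K; rewrite ffunE extZE lmulE mulr_sumr; apply: eq_bigr => a _.
rewrite /cpartial -/(below a K).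
have D x := cderiv_eval s (K :\ a) x.
rewrite (@partial_regular _ _ first _ _ a (fun x => (D x).1)).
rewrite (@partial_regular _ _ first _ _ a (fun x => (D x).2)).
rewrite /delta; case: (a == first); rewrite ?mul1r ?mul0r ?mulr0 ?mulr1 ?mul0r ?mulr0 //.
set E := feval _ _ _; rewrite mulrCA; congr (_ * _).
by case: E => u v.
Qed.

Lemma sform_bidegree p q s : bidegree p q (sform s) = sform (sym_bidegree p q s).
Proof.
by apply/funext => c; apply/funext => y; rewrite /bidegree /sform -feval_bidegree.
Qed.

Lemma sform_star s : star (sform s) = sform (sym_star s).
Proof.
by apply/funext => c; apply/funext => y; rewrite /star /sform -feval_star.
Qed.

Lemma sform_cat s s' : sform (s ++ s') = sform s + sform s'.
Proof. by apply/funext => c; apply/funext => y; exact: feval_cat. Qed.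

Lemma sform_nil : sform [::] = 0.
Proof. by apply/funext => c; apply/funext => y; exact: feval_nil. Qed.

Lemma sform_opp s : sform (sym_opp s) = - sform s.
Proof. by apply/funext => c; apply/funext => y; exact: feval_opp. Qed.

Lemma sform_flatten (I : Type) (r : seq I) (F : I -> seq item) :
  sform (flatten [seq F k | k <- r]) = \sum_(k <- r) sform (F k).
Proof.
elim: r => [|k r IH]; first by rewrite big_nil sform_nil.
by rewrite big_cons /= sform_cat IH.
Qed.

Lemma sform_del s : del (sform s) = sform (sym_del s).
Proof.
rewrite sform_flatten /del -[LHS](big_mkord xpredT (fun p =>
  \sum_(q < 5) bidegree p.+1 q (exterior_d (bidegree p q (sform s))))).
apply: eq_bigr => p _; rewrite sform_flatten -[LHS](big_mkord xpredT (fun q =>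
  bidegree p.+1 q (exterior_d (bidegree p q (sform s))))).
by apply: eq_bigr => q _; rewrite sform_bidegree sform_d sform_bidegree.
Qed.

Lemma sform_delbar s : delbar (sform s) = sform (sym_delbar s).
Proof.
rewrite sform_flatten /delbar -[LHS](big_mkord xpredT (fun p =>
  \sum_(q < 5) bidegree p q.+1 (exterior_d (bidegree p q (sform s))))).
apply: eq_bigr => p _; rewrite sform_flatten -[LHS](big_mkord xpredT (fun q =>
  bidegree p q.+1 (exterior_d (bidegree p q (sform s))))).
by apply: eq_bigr => q _; rewrite sform_bidegree sform_d sform_bidegree.
Qed.

Lemma sform_laplacian D s : laplacian D (sform s) = sform (sym_laplacian D s).
Proof.
have da s' : del_adj (sform s') = sform (sym_del_adj s').
  by rewrite /del_adj !(sform_star, sform_delbar) -sform_opp.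
have dba s' : delbar_adj (sform s') = sform (sym_delbar_adj s').
  by rewrite /delbar_adj !(sform_star, sform_del) -sform_opp.
by case: D; rewrite /laplacian /sym_laplacian !(da, dba, sform_del, sform_delbar) !sform_cat.
Qed.

End AlmostKahlerTorus.

(** * Locality of the differential operators *)

Section Locality.
Local Open Scope classical_set_scope.
Context {R : realType} {n : nat} (X : almost_Hermitian R n).
Local Notation dform := (chart X -> 'rV[R]_(n.*2) -> ext R n.*2).
Implicit Types (alpha beta : dform).

Lemma eq_formD alpha alpha' beta beta' :
  eq_form alpha alpha' -> eq_form beta beta' -> eq_form (alpha + beta) (alpha' + beta').
Proof.
move=> ea eb c y yc.
by rewrite -[LHS]/(alpha c y + beta c y) ea // eb.
Qed.

Lemma eq_formN alpha alpha' : eq_form alpha alpha' -> eq_form (- alpha) (- alpha').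
Proof. by move=> ea c y yc; rewrite -[LHS]/(- alpha c y) ea. Qed.

Lemma eq_form_sum (I : Type) (r : seq I) (F G : I -> dform) :
  (forall i, eq_form (F i) (G i)) ->
  eq_form (\sum_(i <- r) F i) (\sum_(i <- r) G i).
Proof.
move=> FG; elim: r => [|i r IH]; first by rewrite !big_nil.
by rewrite !big_cons; exact: eq_formD.
Qed.

(** A derivative at y depends only on the germ at y, and chart images are open. *)
Lemma eq_form_d alpha beta : eq_form alpha beta ->
  eq_form (exterior_d alpha) (exterior_d beta).
Proof.
move=> eab c y yc; apply/ffunP => K; rewrite !ffunE; apply: eq_bigr => a _.
congr (_ * _); have nc : \forall z \near y, chart_im c z.
  by apply: open_nbhs_nbhs; split => //; exact: open_chart_im.
by rewrite /cpartial /partial; congr (_ +i* _); apply: near_eq_derive;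
  move: nc; apply: filterS => z zc; rewrite eab.
Qed.

Lemma eq_form_bidegree p q alpha beta : eq_form alpha beta ->
  eq_form (bidegree p q alpha) (bidegree p q beta).
Proof. by move=> eab c y yc; rewrite /bidegree eab. Qed.

Lemma eq_form_star alpha beta : eq_form alpha beta -> eq_form (star alpha) (star beta).
Proof. by move=> eab c y yc; rewrite /star eab. Qed.

Lemma eq_form_del alpha beta : eq_form alpha beta -> eq_form (del alpha) (del beta).
Proof.
move=> eab; apply: eq_form_sum => p; apply: eq_form_sum => q.
exact/eq_form_bidegree/eq_form_d/eq_form_bidegree.
Qed.

Lemma eq_form_delbar alpha beta :
  eq_form alpha beta -> eq_form (delbar alpha) (delbar beta).
Proof.
move=> eab; apply: eq_form_sum => p; apply: eq_form_sum => q.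
exact/eq_form_bidegree/eq_form_d/eq_form_bidegree.
Qed.

Lemma eq_form_del_adj alpha beta :
  eq_form alpha beta -> eq_form (del_adj alpha) (del_adj beta).
Proof. by move=> eab; exact/eq_formN/eq_form_star/eq_form_delbar/eq_form_star. Qed.

Lemma eq_form_delbar_adj alpha beta :
  eq_form alpha beta -> eq_form (delbar_adj alpha) (delbar_adj beta).
Proof. by move=> eab; exact/eq_formN/eq_form_star/eq_form_del/eq_form_star. Qed.

Lemma eq_form_laplacian D alpha beta :
  eq_form alpha beta -> eq_form (laplacian D alpha) (laplacian D beta).
Proof.
move=> eab; case: D; rewrite /laplacian; repeat lazymatch goal with
| |- eq_form (_ + _) _ => apply: eq_formD
| |- eq_form (del _) _ => apply: eq_form_del
| |- eq_form (delbar _) _ => apply: eq_form_delbar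
| |- eq_form (del_adj _) _ => apply: eq_form_del_adj
| |- eq_form (delbar_adj _) _ => apply: eq_form_delbar_adj
| |- _ => exact: eab
end.
Qed.

End Locality.

(** * Harmonic forms and Lefschetz sums on the torus *)

Section Harmonic.
Local Open Scope classical_set_scope.
Context {R : realType}.
Local Notation X := (@ktorus R).
Implicit Types (s : seq item) (D : laplacian_kind).

(** The symbolic Laplacian can be required to be literally empty because, for the witnesses, each of
    its terms vanishes at the first operator applied. *)
Lemma harmonic_sform D p q s : sym_bidegree p q s = s ->
  sym_laplacian D s = [::] -> harmonic_forms X D p q (sform s).
Proof.
move=> pqs lap0; split; last by rewrite sform_laplacian lap0 sform_nil.
split; first exact: sform_is_form.
by rewrite sform_bidegree pqs.
Qed.

(** One component at the origin suffices. Asking for a nonzero real integer turns the inequality in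
    R[i] into one between integers. *)
Definition nonzero_laplacian D k s : bool :=
  let z := eval_origin k (sym_laplacian D s) in (z.1 != 0) && (z.2 == 0).

Lemma nonharmonic_sform D k s : nonzero_laplacian D k s ->
  ~ eq_form (laplacian D (sform s)) (0 : chart X -> 'rV[R]_(4.*2) -> ext R 4.*2).
Proof.
rewrite /nonzero_laplacian; set e := eval_origin _ _ => /andP[e1 /eqP e2].
(* The chart centred at 0, evaluated at its centre. *)
rewrite sform_laplacian => /(_ 0 0).
have b0 : ball (0 : 'rV[R]_(4.*2)) (pi / 2) 0.
  by apply: ballxx; rewrite divr_gt0 // pi_gt0.
move=> /(_ b0) /ffunP /(_ (state_set k)).
rewrite ext0E /sform mxE -eval_originP -/e.
have -> : e = (e.1, 0) by case: (e) e2 => ? ? /= ->.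
by rewrite gval_int => /eqP; rewrite intr_eq0 (negbTE e1).
Qed.

(** By pointwise uniqueness, the primitive forms of any Lefschetz sum equal to [sform sa] are
    [sform sb] and [sform sc] on the chart images, so these inherit harmonicity. *)
Lemma lefschetz_sum_sform D sa sb sc :
  sym_bidegree 1 1 sb = sb ->
  sym_is0 (sym_lef sb ++ sc ++ sym_opp sa) ->
  sym_is0 (sym_dlef sb) -> sym_is0 (sym_dlef sc) ->
  lefschetz_sum22 X D (sform sa) ->
  eq_form (laplacian D (sform sb)) (0 : chart X -> 'rV[R]_(4.*2) -> ext R 4.*2) /\
  eq_form (laplacian D (sform sc)) (0 : chart X -> 'rV[R]_(4.*2) -> ext R 4.*2).
Proof.
move=> b11 abc0 db0 dc0 [z [b [c [[[[_ b11'] pb] [_ hb]] [[_ pc] [_ hc]] E]]]].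
have P ch y : chart_im ch y -> sform sb ch y - b ch y = 0 /\ sform sc ch y - c ch y = 0.
  move=> yc; set x := y 0 first; have uw := weight_unimodular x.
  (* The difference of the two decompositions is a decomposition of 0, with -z in front of
     omega^2. *)
  apply: (@lefschetz_unique _ _ (- z)) => //.
  - move=> K cK; rewrite extDE extNE /sform -/x -b11 -feval_bidegree.
    rewrite ext_bidegree_homogeneous // -(b11' ch y yc) /bidegree.
    by rewrite ext_bidegree_homogeneous // subrr.
  - have /dlef_eq0 db : ext_starinv 4 (frame_J (weight x)) (frame_g (weight x))
       (wedge (ext_omega (frame_J (weight x)) (frame_g (weight x)))
          (ext_star 4 (frame_J (weight x)) (frame_g (weight x)) (b ch y))) = 0.
      exact: (pb ch y yc).
    by rewrite -scaleN1r dlefD dlefZ db // scaler0 addr0 /sform feval_dlef feval_is0.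
  - have /dlef_eq0 dc : ext_starinv 4 (frame_J (weight x)) (frame_g (weight x))
       (wedge (ext_omega (frame_J (weight x)) (frame_g (weight x)))
          (ext_star 4 (frame_J (weight x)) (frame_g (weight x)) (c ch y))) = 0.
      exact: (pc ch y yc).
    by rewrite -scaleN1r dlefD dlefZ dc // scaler0 addr0 /sform feval_dlef feval_is0.
  have := E ch y yc.
  rewrite -[X in _ = X -> _]/(z *: wedge (ext_omega (frame_J (weight x)) (frame_g (weight x)))
     (ext_omega (frame_J (weight x)) (frame_g (weight x))) +
     wedge (ext_omega (frame_J (weight x)) (frame_g (weight x))) (b ch y) + c ch y).
  rewrite !wedge_omega // omega_lef // => Ea.
  have := feval_is0 x abc0; rewrite !feval_cat feval_opp -feval_lef.
  rewrite -[feval sa x]/(sform sa ch y) Ea => E0.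
  rewrite -[RHS]E0 -[sform sb ch y]/(feval sb x) -[sform sc ch y]/(feval sc x).
  have -> : lef (feval sb x - b ch y) = lef (feval sb x) - lef (b ch y).
    by rewrite -scaleN1r lefD lefZ scaleN1r.
  apply/ffunP => K; rewrite !(extDE, extNE, extZE); ring.
have eb : eq_form (sform sb) b.
  by move=> ch y /P[/eqP + _]; rewrite subr_eq0 => /eqP.
have ec : eq_form (sform sc) c.
  by move=> ch y /P[_ /eqP]; rewrite subr_eq0 => /eqP.
split=> ch y yc; first by rewrite (eq_form_laplacian D eb yc); exact: hb.
by rewrite (eq_form_laplacian D ec yc); exact: hc.
Qed.

Lemma omega_sform : omega (X := X) = sform (sym_lef [:: ((1, 0), (0%N, 0%N, [::]))]).
Proof.
apply/funext => c; apply/funext => y; rewrite /sform -feval_lef feval1 /=.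
rewrite gval_int !expr0 mulr1 mulr1 scale1r /omega omega_lef; last exact: weight_unimodular.
congr lef; rewrite /monomial -tensor_one; congr tensor; apply/funext => j.
by rewrite /st nth_nil.
Qed.

(** The omega_j have constant coefficients and even states, on which [half_deriv] is empty, so
    [sym_d] computes to the empty list. *)
Lemma ktorus_almost_Kahler : almost_Kahler X.
Proof. by rewrite /almost_Kahler omega_sform sform_d sform_nil. Qed.

Lemma not_lefschetz_sum D k sa sb sc :
  sym_bidegree 2 2 sa = sa -> sym_laplacian D sa = [::] ->
  sym_bidegree 1 1 sb = sb -> sym_is0 (sym_lef sb ++ sc ++ sym_opp sa) ->
  sym_is0 (sym_dlef sb) -> sym_is0 (sym_dlef sc) ->
  nonzero_laplacian D k sb || nonzero_laplacian D k sc ->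
  ~ (harmonic_forms X D 2 2 `<=` lefschetz_sum22 X D).
Proof.
move=> a22 a0 b11 abc0 db0 dc0 nz /(_ _ (harmonic_sform a22 a0)).
move=> /(lefschetz_sum_sform b11 abc0 db0 dc0)[hb hc].
by case/orP: nz => nz; [exact: (nonharmonic_sform nz hb) | exact: (nonharmonic_sform nz hc)].
Qed.

End Harmonic.

Definition unit_item (r : int) (t : seq (bool * bool)) : item := ((r, 0), (0%N, 0%N, t)).

(** * The witness forms *)

Section Witnesses.
Let o := (false, false).
Let f := (true, false).
Let b := (false, true).
Let w := (true, true).

(** In these names f stands for phi, b for conj phi and w for omega, followed by the index counted
    from 1. *)
Definition w1_f2_b3 := [:: w; f; b; o].
Definition w4_f2_b3 := [:: o; f; b; w].
Definition w1_b2_f3 := [:: w; b; f; o].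
Definition w4_b2_f3 := [:: o; b; f; w].
Definition b2_f3 := [:: o; b; f; o].

End Witnesses.

Local Open Scope classical_set_scope.

(** For del and BC the failing part is b, which is not del-closed. For delbar and A the form b is
    harmonic, and the (2,2)-part fails through omega_1 /\ b. *)
Lemma ktorus_not_lefschetz_sum (R : realType) D :
  ~ (harmonic_forms (@ktorus R) D 2 2 `<=` lefschetz_sum22 (@ktorus R) D).
Proof.
(* [k0] selects the component at dx2 dx3, which tests the (1,1)-part; [k1] selects the one at dx1
   dy1 dx2 dx3, which tests the (2,2)-part. *)
pose k0 : seq (bool * bool) := [:: (false, false); (true, false); (true, false); (false, false)].
pose k1 : seq (bool * bool) := [:: (true, true); (true, false); (true, false); (false, false)].
case: D.
- apply: (@not_lefschetz_sum R Lap_del k0 [:: unit_item 2 w1_b2_f3] [:: unit_item 1 b2_f3]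
    [:: unit_item 1 w1_b2_f3; unit_item (-1) w4_b2_f3]); vm_compute; reflexivity.
- apply: (@not_lefschetz_sum R Lap_delbar k1 [:: unit_item 2 w4_b2_f3] [:: unit_item 1 b2_f3]
    [:: unit_item 1 w4_b2_f3; unit_item (-1) w1_b2_f3]); vm_compute; reflexivity.
- apply: (@not_lefschetz_sum R Lap_BC k0 [:: unit_item 2 w1_b2_f3] [:: unit_item 1 b2_f3]
    [:: unit_item 1 w1_b2_f3; unit_item (-1) w4_b2_f3]); vm_compute; reflexivity.
- apply: (@not_lefschetz_sum R Lap_A k1 [:: unit_item 2 w4_b2_f3] [:: unit_item 1 b2_f3]
    [:: unit_item 1 w4_b2_f3; unit_item (-1) w1_b2_f3]); vm_compute; reflexivity.
Qed.

Close Scope ring_scope.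
Close Scope complex_scope.

Theorem corollary5p2 (R : realType) :
  exists X : almost_Hermitian R 4,
    [/\ compact [set: X],
        almost_Kahler X,
        ~ (harmonic_forms X Lap_del 2 2 `<=` harmonic_forms X Lap_BC 2 2),
        ~ (harmonic_forms X Lap_delbar 2 2 `<=` harmonic_forms X Lap_A 2 2) &
        forall D : laplacian_kind,
          ~ (harmonic_forms X D 2 2 `<=` lefschetz_sum22 X D)].
Proof.
exists (@ktorus R); split.
- exact: (torus_compact (pi_gt0 R)).
- exact: ktorus_almost_Kahler.
- move=> sub; have [_] : harmonic_forms (@ktorus R) Lap_BC 2 2 (sform [:: unit_item 1 w4_f2_b3]).
    by apply/sub/harmonic_sform; vm_compute.
  (* The Laplacian is tested at dx2 dx3 dx4 dy4, where the form itself has coefficient 1 at the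
     origin. *)
  apply: (@nonharmonic_sform R Lap_BC
    [:: (false, false); (true, false); (true, false); (true, true)]).
  by vm_compute; reflexivity.
- move=> sub; have [_] : harmonic_forms (@ktorus R) Lap_A 2 2 (sform [:: unit_item 1 w1_f2_b3]).
    by apply/sub/harmonic_sform; vm_compute.
  apply: (@nonharmonic_sform R Lap_A
    [:: (true, true); (true, false); (true, false); (false, false)]).
  by vm_compute.
exact: ktorus_not_lefschetz_sum.
Qed.
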